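(* For every integer $d \ge 1$ there exists a positive constant $c_d$ depending only on $d$ such that for every integer $n \ge 2$, $$R_n(\mathcal{F}_{\mathcal{G}_1(\Gamma)}, h^2) \;\ge\; c_d\,\frac{(\log n)^d}{n} \qquad \text{for all } \Gamma \ge c_d^{-1},$$ where $R_n(\mathcal{F}_{\mathcal{G}_1(\Gamma)}, h^2)$ is the minimax risk, under squared Hellinger loss and based on $n$ i.i.d. observations, over Gaussian location mixture densities on $\mathbb{R}^d$ whose mixing measure lies in the sub-Gaussian class $\mathcal{G}_1(\Gamma)$.
   Context: Let $\phi(x) = (2\pi)^{-1/2} e^{-x^2/2}$ be the standard univariate normal density. For a class $\mathcal{G}$ of (Borel) probability measures on $\mathbb{R}^d$, $\mathcal{F}_{\mathcal{G}}$ denotes the class of all densities on $\mathbb{R}^d$ of the form $$(x_1,\ldots,x_d) \mapsto \int \phi(x_1-u_1)\phi(x_2-u_2)\cdots\phi(x_d-u_d)\, dG(u_1,\ldots,u_d), \qquad G \in \mathcal{G}.$$ For a constant $\Gamma > 0$, $\mathcal{G}_1(\Gamma)$ is the class of all probability measures $G$ on $\mathbb{R}^d$ satisfying $$G\{u : \|u\| > t\} \le \Gamma \exp(-t^2/\Gamma) \quad \text{for all } t > 0,$$ where $\|\cdot\|$ is the Euclidean norm. The squared Hellinger loss is $h^2(f,g) := \int_{\mathbb{R}^d} \left(\sqrt{f(x)}-\sqrt{g(x)}\right)^2 dx$. One observes i.i.d. random vectors $X_1,\ldots,X_n$ with unknown density $f^* \in \mathcal{F}_{\mathcal{G}}$.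 The minimax risk is $$R_n(\mathcal{F}_{\mathcal{G}}, h^2) := \inf_{\hat f_n}\ \sup_{f^*\in\mathcal{F}_{\mathcal{G}}} \mathbb{E}_{f^*} h^2(\hat f_n, f^* ),$$ where the infimum is over all estimators $\hat f_n$, i.e. measurable functions of the data $X_1,\ldots,X_n$ taking values in nonnegative functions on $\mathbb{R}^d$, and $\mathbb{E}_{f^*}$ is expectation when $X_1,\ldots,X_n$ are i.i.d. with density $f^*$. *)

(* Defs.v *)
From HB Require Import structures.
From mathcomp Require Import all_boot all_order all_algebra.
From mathcomp Require Import all_classical all_reals all_analysis.
From mathcomp Require Import measurable_realfun normal_distribution measurable_fun_approximation.

Set Implicit Arguments.
Unset Strict Implicit.
Unset Printing Implicit Defensive.

Import Order.TTheory GRing.Theory Num.Theory.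
Import numFieldNormedType.Exports.

Local Open Scope classical_set_scope.
Local Open Scope ring_scope.

Section cons_measure.
Context d (T : measurableType d) (R : realType) (n : nat).
Variables (m : {sigma_finite_measure set T -> \bar R})
  (mn : {sigma_finite_measure set (n.-tuple T) -> \bar R}).

Definition tcons (z : T * n.-tuple T) : n.+1.-tuple T := [tuple of z.1 :: z.2].

Lemma measurable_tcons : measurable_fun setT tcons.
Proof. exact: (measurable_cons measurable_fst measurable_snd). Qed.

Definition cons_measure : set (n.+1.-tuple T) -> \bar R :=
  pushforward (m \x mn)%E tcons.

Let cm0 : cons_measure set0 = 0%E.
Proof. by rewrite /cons_measure /pushforward preimage_set0 measure0. Qed.

Let cm_ge0 A : (0 <= cons_measure A)%E.
Proof. by rewrite /cons_measure /pushforward measure_ge0. Qed.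

Let cm_sigma_additive : semi_sigma_additive cons_measure.
Proof.
have mpre A : measurable A -> measurable (tcons @^-1` A).
  by move=> mA; rewrite -[X in measurable X]setTI; exact: measurable_tcons.
move=> F mF tF mUF; rewrite /cons_measure /pushforward preimage_bigcup.
apply: measure_semi_sigma_additive.
- by move=> k; exact: mpre.
- apply/trivIsetP => /= i j _ _ ij; rewrite -preimage_setI.
  by move/trivIsetP : tF => /(_ _ _ _ _ ij) ->//; rewrite preimage_set0.
- by rewrite -preimage_bigcup; exact: mpre.
Qed.

HB.instance Definition _ :=
  isMeasure.Build _ _ _ cons_measure cm0 cm_ge0 cm_sigma_additive.

Let cm_sigma_finite : sigma_finite setT cons_measure.
Proof.
have /sigma_finiteP[F [TF ndF Foo]] := sigma_finiteT m.
have /sigma_finiteP[G [TG ndG Goo]] := sigma_finiteT mn.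
pose u (t : n.+1.-tuple T) := (thead t, [tuple of behead t]).
have mu : measurable_fun setT u.
  apply: measurable_fun_pair; first exact: measurable_tnth.
  exact: measurable_behead.
have uK z : u (tcons z) = z.
  by case: z => x t; congr pair => //=; apply: val_inj.
exists (fun k => u @^-1` (F k `*` G k)) => [|k].
  apply/seteqP; split => // t _.
  have [k _ Fk] : (\bigcup_k F k) (u t).1 by rewrite -TF.
  have [l _ Gl] : (\bigcup_k G k) (u t).2 by rewrite -TG.
  exists (maxn k l) => //; split.
    by move: Fk; exact/subsetPset/ndF/leq_maxl.
  by move: Gl; exact/subsetPset/ndG/leq_maxr.
have [mFk Fkoo] := Foo k; have [mGk Gkoo] := Goo k; split.
  by rewrite -[X in measurable X]setTI; apply: mu => //; exact: measurableX.
rewrite /cons_measure /pushforward.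
rewrite [X in (_ X < _)%E](_ : _ = F k `*` G k); last first.
  by apply/funext => z; rewrite /preimage /mkset uK.
by rewrite product_measure1E// lte_mul_pinfty// ge0_fin_numE.
Qed.

HB.instance Definition _ :=
  Measure_isSigmaFinite.Build _ _ _ cons_measure cm_sigma_finite.

End cons_measure.

(* The n-fold product measure on the product sigma-algebra of [n.-tuple T]. *)
Fixpoint tuple_measure d (T : measurableType d) (R : realType)
    (m : {sigma_finite_measure set T -> \bar R}) (n : nat) :
    {sigma_finite_measure set (n.-tuple T) -> \bar R} :=
  match n return {sigma_finite_measure set (n.-tuple T) -> \bar R} with
  | 0 => \d_([tuple] : 0.-tuple T)
  | k.+1 => cons_measure m (tuple_measure m k)
  end.

Lemma tuple_measureE d (T : measurableType d) (R : realType)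
    (m : {sigma_finite_measure set T -> \bar R}) (n : nat) (A : 'I_n -> set T) :
  (forall i, measurable (A i)) ->
  tuple_measure m n [set t | forall i, A i (tnth t i)] =
  (\prod_(i < n) m (A i))%E.
Proof.
elim: n A => [|n IH] A mA.
  by rewrite big_ord0 /= diracE mem_set// => -[].
rewrite big_ord_recl /= /cons_measure /pushforward.
pose B := [set t : n.-tuple T | forall i, A (lift ord0 i) (tnth t i)].
have mB : measurable B.
  rewrite (_ : B = \big[setI/setT]_(i < n)
      ((fun t => tnth t i) @^-1` A (lift ord0 i))).
    apply: bigsetI_measurable => i _; rewrite -[X in measurable X]setTI.
    exact: measurable_tnth.
  apply/seteqP; split => t.
    by move=> Bt; apply: (big_ind (fun S : set _ => S t)) => // X Y.
  by move=> + i; rewrite (bigD1 i)//= => -[].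
rewrite -IH// -product_measure1E//; congr (_ _).
apply/seteqP; split => -[x t] /= H.
  split; first exact: (H ord0).
  by move=> i; have := H (lift ord0 i); rewrite tnthS.
by move=> i; case: (unliftP ord0 i) => [j|] ->; rewrite ?tnthS//; case: H.
Qed.

(* R^d; [measurableTypeR R] is R with its Borel sigma-algebra, the domain of
   [lebesgue_measure]. *)
Notation Rvec R d := (d.-tuple (measurableTypeR R)).

Definition lebesgue_vec (R : realType) (d : nat) :
    {sigma_finite_measure set (Rvec R d) -> \bar R} :=
  tuple_measure (@lebesgue_measure R) d.

Record density (R : realType) (d : nat) := Density {
  density_fun :> Rvec R d -> R ;
  measurable_density : measurable_fun setT density_fun ;
  density_ge0 : forall x, 0 <= density_fun x ;
  integral_density : (\int[lebesgue_vec R d]_x (density_fun x)%:E = 1)%E }.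

Section density_prob.
Context {R : realType} {d : nat} (f : density R d).

Definition density_prob (A : set (Rvec R d)) : \bar R :=
  (\int[lebesgue_vec R d]_(x in A) (f x)%:E)%E.

Let dp0 : density_prob set0 = 0%E.
Proof. by rewrite /density_prob integral_set0. Qed.

Let dp_ge0 A : (0 <= density_prob A)%E.
Proof. by apply: integral_ge0 => x _; rewrite lee_fin density_ge0. Qed.

Let dp_sigma_additive : semi_sigma_additive density_prob.
Proof.
move=> F mF tF mUF; rewrite /density_prob ge0_integral_bigcup//=.
- apply: is_cvg_ereal_nneg_natsum_cond => k _ _; exact: dp_ge0.
- apply: (measurable_funS measurableT) => //; apply/measurable_EFinP.
  exact: measurable_density.
- by move=> x _; rewrite lee_fin density_ge0.
Qed.

HB.instance Definition _ :=
  isMeasure.Build _ _ _ density_prob dp0 dp_ge0 dp_sigma_additive.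

Let dp_setT : density_prob setT = 1%E.
Proof. exact: integral_density. Qed.

HB.instance Definition _ :=
  Measure_isProbability.Build _ _ _ density_prob dp_setT.

End density_prob.

(* The joint law of n independent observations with density f. *)
Definition iid_law (R : realType) (d : nat) (f : density R d) (n : nat) :
    {sigma_finite_measure set (n.-tuple (Rvec R d)) -> \bar R} :=
  tuple_measure (density_prob f) n.

Section gaussian_mixture.
Context {R : realType} {d : nat}.

Definition gauss_kernel (x u : Rvec R d) : R :=
  \prod_(i < d) normal_pdf 0 1 ((tnth x i : R) - (tnth u i : R)).

Definition mixture_pdf (G : probability (Rvec R d) R) (x : Rvec R d) : R :=
  \int[G]_u gauss_kernel x u.

End gaussian_mixture.

Lemma gauss_kernel_ge0 (R : realType) d (x u : Rvec R d) :
  0 <= gauss_kernel x u.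
Proof. by apply: prodr_ge0 => i _; exact: normal_pdf_ge0. Qed.

Lemma gauss_kernel_ub (R : realType) d (x u : Rvec R d) :
  gauss_kernel x u <= normal_peak 1 ^+ d.
Proof.
rewrite -[X in _ ^+ X]card_ord -prodr_const.
apply: ler_prod => i _; rewrite normal_pdf_ge0/=.
by apply: normal_pdf_ub; rewrite oner_neq0.
Qed.

Lemma measurable_gauss_kernel (R : realType) d :
  measurable_fun setT (fun z : Rvec R d * Rvec R d => gauss_kernel z.1 z.2).
Proof.
apply: measurable_prod => i _.
apply: (measurableT_comp (measurable_normal_pdf 0 1)).
apply: measurable_funB.
  exact: (measurableT_comp (measurable_tnth i) measurable_fst).
exact: (measurableT_comp (measurable_tnth i) measurable_snd).
Qed.

Lemma measurable_gauss_kernel_l (R : realType) d (u : Rvec R d) :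
  measurable_fun setT (gauss_kernel ^~ u).
Proof.
apply: (measurableT_comp (@measurable_gauss_kernel R d)
  (g := fun x => (x, u))).
exact: measurable_fun_pair.
Qed.

Lemma measurable_gauss_kernel_r (R : realType) d (x : Rvec R d) :
  measurable_fun setT (gauss_kernel x).
Proof.
apply: (measurableT_comp (@measurable_gauss_kernel R d)
  (g := fun u => (x, u))).
exact: measurable_fun_pair.
Qed.

Lemma integral_gauss_kernel (R : realType) d (u : Rvec R d) :
  (\int[lebesgue_vec R d]_x (gauss_kernel x u)%:E = 1)%E.
Proof.
have mE n (v : Rvec R n) :
    measurable_fun setT (fun x => (gauss_kernel x v)%:E).
  by apply/measurable_EFinP; exact: measurable_gauss_kernel_l.
elim: d u => [u|d IH u].
  rewrite integral_dirac//; last exact: mE.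
  by rewrite diracT mul1e /gauss_kernel big_ord0.
transitivity (\int[(@lebesgue_measure R \x lebesgue_vec R d)%E]_z
    (gauss_kernel (tcons z) u)%:E)%E.
  apply: (ge0_integral_pushforward (@measurable_tcons _ _ _)) => //.
    exact: mE.
  by move=> x _; rewrite lee_fin gauss_kernel_ge0.
transitivity (\int[@lebesgue_measure R]_x fubini_F (lebesgue_vec R d)
    (fun z => (gauss_kernel (tcons z) u)%:E) x)%E.
  apply: fubini_tonelli1.
    by apply: measurableT_comp (mE _ u) _; exact: measurable_tcons.
  by move=> x; rewrite lee_fin gauss_kernel_ge0.
pose v : Rvec R d := [tuple of behead u].
rewrite -[RHS](integral_normal_pdf (thead u : R) 1).
apply: eq_integral => x _; rewrite /fubini_F/=.
under eq_integral => y _.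
  rewrite (_ : gauss_kernel _ _ =
    normal_pdf (thead u : R) 1 x * gauss_kernel y v); last first.
    rewrite /gauss_kernel big_ord_recl; congr (_ * _).
      by rewrite !normal_pdfE ?oner_neq0// /normal_fun subr0.
    apply: eq_bigr => i _; rewrite tnthS; congr (normal_pdf _ _ (_ - _)).
    by rewrite [in LHS](tuple_eta u) tnthS.
  rewrite EFinM; over.
rewrite ge0_integralZl//; last 3 first.
- exact: mE.
- by move=> y _; rewrite lee_fin gauss_kernel_ge0.
- by rewrite lee_fin normal_pdf_ge0.
by rewrite IH mule1.
Qed.

Section mixture.
Context {R : realType} {d : nat} (G : probability (Rvec R d) R).

Lemma mixture_pdfE x :
  ((mixture_pdf G x)%:E = \int[G]_u (gauss_kernel x u)%:E)%E.
Proof.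
rewrite /mixture_pdf /Rintegral fineK// ge0_fin_numE; last first.
  by apply: integral_ge0 => u _; rewrite lee_fin gauss_kernel_ge0.
apply: (@le_lt_trans _ _ (\int[G]_u (normal_peak 1 ^+ d)%:E)%E).
  apply: ge0_le_integral => //.
  - by move=> u _; rewrite lee_fin gauss_kernel_ge0.
  - by apply/measurable_EFinP; exact: measurable_gauss_kernel_r.
  - by move=> u _; rewrite lee_fin gauss_kernel_ub.
by rewrite integral_cst// [X in (_ * X)%E]probability_setT mule1 ltry.
Qed.

Lemma mixture_pdf_ge0 x : 0 <= mixture_pdf G x.
Proof.
apply: fine_ge0; apply: integral_ge0 => u _.
by rewrite lee_fin gauss_kernel_ge0.
Qed.

Let mK : measurable_fun setT
  (fun z : Rvec R d * Rvec R d => (gauss_kernel z.1 z.2)%:E).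
Proof. by apply/measurable_EFinP; exact: measurable_gauss_kernel. Qed.

Let K_ge0 (z : Rvec R d * Rvec R d) : (0 <= (gauss_kernel z.1 z.2)%:E)%E.
Proof. by rewrite lee_fin gauss_kernel_ge0. Qed.

Lemma measurable_mixture_pdf : measurable_fun setT (mixture_pdf G).
Proof.
apply/measurable_EFinP.
rewrite (_ : _ \o _ = fubini_F G
  (fun z : Rvec R d * Rvec R d => (gauss_kernel z.1 z.2)%:E)).
  exact: measurable_fun_fubini_tonelli_F.
by apply/funext => x; rewrite /= mixture_pdfE.
Qed.

Lemma integral_mixture_pdf :
  (\int[lebesgue_vec R d]_x (mixture_pdf G x)%:E = 1)%E.
Proof.
under eq_integral do rewrite mixture_pdfE.
rewrite (@fubini_tonelli _ _ _ _ _ (lebesgue_vec R d) G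
  (fun z => (gauss_kernel z.1 z.2)%:E))//=.
under eq_integral do rewrite integral_gauss_kernel.
by rewrite integral_cst// mul1e; exact: probability_setT.
Qed.

Definition mixture : density R d :=
  Density measurable_mixture_pdf mixture_pdf_ge0 integral_mixture_pdf.

End mixture.

Definition mixture_class (R : realType) (d : nat)
    (GG : set (probability (Rvec R d) R)) : set (density R d) :=
  [set mixture G | G in GG].

Definition enorm (R : realType) (d : nat) (u : Rvec R d) : R :=
  Num.sqrt (\sum_(i < d) (tnth u i : R) ^+ 2).

Definition subgauss_class (R : realType) (d : nat) (Gamma : R) :
    set (probability (Rvec R d) R) :=
  [set G : probability (Rvec R d) R | forall t : R, 0 < t ->
    (G [set u | (t < enorm u)%R] <= (Gamma * expR (- t ^+ 2 / Gamma))%:E)%E].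

Definition hellinger2 (R : realType) (d : nat) (f g : Rvec R d -> R) : \bar R :=
  (\int[lebesgue_vec R d]_x ((Num.sqrt (f x) - Num.sqrt (g x)) ^+ 2)%:E)%E.

(* Estimates are nonnegative functions, not necessarily densities.
   Measurability is joint in the data and the evaluation point. *)
Definition estimators (R : realType) (d n : nat) :
    set (n.-tuple (Rvec R d) -> Rvec R d -> R) :=
  [set fhat : n.-tuple (Rvec R d) -> Rvec R d -> R | measurable_fun setT
      (fun z : n.-tuple (Rvec R d) * Rvec R d => fhat z.1 z.2) /\
    forall X x, 0 <= fhat X x].

Definition hellinger_risk (R : realType) (d n : nat)
    (fhat : n.-tuple (Rvec R d) -> Rvec R d -> R) (f : density R d) : \bar R :=
  (\int[iid_law f n]_X hellinger2 (fhat X) f)%E.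

Arguments subgauss_class {R} d Gamma.
Arguments estimators R d n : clear implicits.

Definition minimax_risk (R : realType) (d n : nat)
    (F : set (density R d)) : \bar R :=
  ereal_inf [set ereal_sup [set hellinger_risk fhat f | f in F]
            | fhat in estimators R d n].

Arguments minimax_risk {R d} n F.

(* Main.v *)
Require Import Defs.
From mathcomp Require Import all_boot all_order all_algebra.
From mathcomp Require Import all_classical all_reals all_analysis.
From mathcomp Require Import measurable_realfun measurable_fun_approximation.
From mathcomp Require Import ring lra.

Set Implicit Arguments.
Unset Strict Implicit.
Unset Printing Implicit Defensive.

Import Order.TTheory GRing.Theory Num.Theory.
Import numFieldNormedType.Exports.

Local Open Scope classical_set_scope.
Local Open Scope ring_scope.

(** The lower bound is obtained by Assouad's method, from a hypercube of
    perturbations of a fixed Gaussian mixing density.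

    In dimension one, convolution with phi maps functions of the form
    polynomial * exp (- u ^ 2 / 2) to functions polynomial * exp (- x ^ 2 / 4)
    with the same degree, and it acts diagonally on suitably scaled Hermite
    polynomials.  With the right scaling the images [bump_obs j] are orthonormal
    in L^2(1 / base_obs), where [base_obs] is the image of the Gaussian base
    density [base_mix].  The smoothing damps the j-th function only
    geometrically in j: after normalization of the images, the mixing functions
    satisfy |bump_mix j| <= B ^ (j + 1) * base_mix ([bump_mix_le]).  So all the
    degrees up to a multiple of log n can be added to the base density with a
    coefficient of order n ^ (- 1 / 2) and the sum is still a positive mixing
    density.  In dimension d, tensor products give m ^ d directions with m of
    order log n.

    Switching each direction on or off yields a hypercube of mixture densities
    that all lie between one half and three halves of the base density.
    Orthonormality makes the squared Hellinger distance of two vertices at least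
    of the order of their Hamming distance divided by n ([pobs_separation]),
    whereas two neighbouring vertices have Hellinger affinity 1 - O(1 / n)
    ([pobs_affinity]) and hence cannot be told apart from n observations.
    Assouad's lemma ([assouad]) then gives a risk of order (log n) ^ d / n.  The
    mixing measures are sub-Gaussian uniformly in n because they are dominated by
    a multiple of the base measure ([pmix_tail]).

    The one-dimensional computations rest on integration by parts against a
    Gaussian ([gmoment_stein]), which gives both the effect of Gaussian averaging
    on Hermite polynomials ([gmoment_herm]) and their orthogonality
    ([gmoment_herm_mul]). *)

(** * Integration over product measures *)

Section tuple_integration.
Context d (T : measurableType d) (R : realType).
Variable m : {sigma_finite_measure set T -> \bar R}.

Lemma ge0_integral_tuple_measureS n (f : n.+1.-tuple T -> \bar R) :
  measurable_fun setT f -> (forall t, 0 <= f t)%E ->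
  (\int[tuple_measure m n.+1]_t f t =
   \int[m]_x \int[tuple_measure m n]_t f (tcons (x, t)))%E.
Proof.
move=> mf f0.
rewrite (ge0_integral_pushforward (@measurable_tcons _ T n))//.
rewrite preimage_setT fubini_tonelli1//=.
exact: (measurableT_comp mf (@measurable_tcons _ T n)).
Qed.

Lemma prod_tcons n (F : 'I_n.+1 -> T -> R) x (t : n.-tuple T) :
  \prod_i F i (tnth (tcons (x, t)) i) =
  F ord0 x * \prod_i F (lift ord0 i) (tnth t i).
Proof.
by rewrite big_ord_recl; congr (_ * _); apply: eq_bigr => i _; rewrite tnthS.
Qed.

Lemma measurable_prod_tnth n (F : 'I_n -> T -> R) :
  (forall i, measurable_fun setT (F i)) ->
  measurable_fun setT (fun t : n.-tuple T => \prod_i F i (tnth t i)).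
Proof.
move=> mF; apply: measurable_prod => i _.
exact: (measurableT_comp (mF i) (measurable_tnth i)).
Qed.

Lemma ge0_integral_tuple_measure_prod n (F : 'I_n -> T -> R) :
  (forall i, measurable_fun setT (F i)) -> (forall i x, 0 <= F i x) ->
  (\int[tuple_measure m n]_t (\prod_i F i (tnth t i))%:E =
   \prod_i \int[m]_x (F i x)%:E)%E.
Proof.
elim: n F => [|n IH] F mF F0.
  rewrite big_ord0 integral_dirac//; first by rewrite diracT mul1e big_ord0.
  by apply/measurable_EFinP; exact: measurable_prod_tnth.
rewrite ge0_integral_tuple_measureS; last 2 first.
  by apply/measurable_EFinP; exact: measurable_prod_tnth.
  by move=> t; rewrite lee_fin prodr_ge0.
under eq_integral => x _.
  under eq_integral => t _ do rewrite prod_tcons EFinM.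
  rewrite ge0_integralZl//; last 3 first.
  - by apply/measurable_EFinP; exact: (measurable_prod_tnth (fun i => mF (lift ord0 i))).
  - by move=> t _; rewrite lee_fin prodr_ge0.
  - by rewrite lee_fin.
  rewrite (IH (fun i => F (lift ord0 i)))//; over.
rewrite ge0_integralZr//.
- by rewrite big_ord_recl.
- by apply/measurable_EFinP; exact: mF.
- by move=> x _; rewrite lee_fin.
- by apply: prode_ge0 => i _; apply: integral_ge0 => x _; rewrite lee_fin.
Qed.

(** Tonelli's theorem on the absolute values. *)
Lemma integrable_tuple_measure_prod n (F : 'I_n -> T -> R) :
  (forall i, m.-integrable setT (EFin \o F i)) ->
  (tuple_measure m n).-integrable setT
    (fun t => (\prod_i F i (tnth t i))%:E).
Proof.
move=> iF; have mF i : measurable_fun setT (F i).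
  by apply/measurable_EFinP; exact: (measurable_int m).
apply/integrableP; split; first by apply/measurable_EFinP; exact: measurable_prod_tnth.
under eq_integral => t _ do rewrite abse_EFin normr_prod.
rewrite (@ge0_integral_tuple_measure_prod _ (fun i x => `|F i x|))//; last first.
  by move=> i; exact: measurableT_comp.
have fin : (\prod_(i < n) \int[m]_x `|F i x|%:E)%E \is a fin_num.
  apply: prode_fin_num => i _; apply: integrable_fin_num => //.
  exact: (integrable_abse (iF i)).
by rewrite ltey_eq fin.
Qed.

(** Fubini's theorem.  It reduces the d-dimensional integrals below to
    one-dimensional ones, since kernels and perturbations are tensor products. *)
Lemma Rintegral_tuple_measure_prod n (F : 'I_n -> T -> R) :
  (forall i, m.-integrable setT (EFin \o F i)) ->
  \int[tuple_measure m n]_t (\prod_i F i (tnth t i)) =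
  \prod_i \int[m]_x F i x.
Proof.
elim: n F => [|n IH] F iF; have mF i : measurable_fun setT (F i).
- by case: i.
- rewrite /Rintegral integral_dirac//.
    by rewrite diracT mul1e !big_ord0.
  by apply/measurable_EFinP; exact: measurable_prod_tnth.
- by apply/measurable_EFinP; exact: (measurable_int m).
have mP := measurable_prod_tnth mF.
have iP := integrable_tuple_measure_prod iF.
have mPt : measurable_fun setT (fun z : T * n.-tuple T =>
    (\prod_i F i (tnth (tcons z) i))%:E).
  by apply/measurable_EFinP; exact: (measurableT_comp mP (@measurable_tcons _ _ n)).
have iP' : (m \x tuple_measure m n)%E.-integrable setT
    (fun z => (\prod_i F i (tnth (tcons z) i))%:E).
  apply/integrableP; split.
    exact: mPt.
  case/integrableP: iP => _; rewrite ge0_integral_tuple_measureS//; last first.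
    by apply: measurableT_comp => //; exact/measurable_EFinP.
  rewrite fubini_tonelli1//=.
  exact: (measurableT_comp (@abse_measurable R setT) mPt).
rewrite /Rintegral (integral_pushforward (@measurable_tcons _ T n))//; last first.
  exact/measurable_EFinP.
rewrite preimage_setT -(@integral12_prod_meas1 _ _ _ _ _ m (tuple_measure m n)
  (fun z => (\prod_i F i (tnth (tcons z) i))%:E))//= /fubini_F.
have i1 := integrable_tuple_measure_prod (fun i => iF (lift ord0 i)).
transitivity (fine (\int[m]_x ((F ord0 x)%:E *
    (\prod_i \int[m]_x F (lift ord0 i) x)%:E))).
  congr fine; apply: eq_integral => x _.
  under eq_integral => t _ do rewrite prod_tcons EFinM.
  rewrite integralZl//; congr (_ * _)%E.
  rewrite -(IH (fun i => F (lift ord0 i)))// /Rintegral fineK//.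
  exact: integrable_fin_num.
rewrite integralZr//; last exact: iF.
by rewrite fineM ?big_ord_recl//; exact/integrable_fin_num/iF.
Qed.

End tuple_integration.

(** * Integration against densities and laws of samples *)

Section density_integration.
Import HBNNSimple.
Context {R : realType} {d : nat}.
Implicit Types (f : density R d).

Lemma measurable_EFin_density f : measurable_fun setT (EFin \o f).
Proof. by apply/measurable_EFinP; exact: measurable_density. Qed.

(** By monotone approximation from simple functions, for which the identity is the
    definition of [density_prob]. *)
Lemma ge0_integral_density_prob f (h : Rvec R d -> \bar R) :
  measurable_fun setT h -> (forall x, 0 <= h x)%E ->
  (\int[density_prob f]_x h x = \int[lebesgue_vec R d]_x ((f x)%:E * h x))%E.
Proof.
move=> mh h0; have mf := measurable_EFin_density f.
pose h_ := nnsfun_approx measurableT mh.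
have f0 x : (0 <= (f x)%:E)%E by rewrite lee_fin density_ge0.
have h_h x : (h_ n x)%:E @[n --> \oo] --> h x.
  by apply: cvg_nnsfun_approx => // *.
transitivity (limn (fun n => \int[density_prob f]_x (h_ n x)%:E)%E).
  rewrite -monotone_convergence//.
  - by apply: eq_integral => x _; apply/esym/cvg_lim => //; exact: h_h.
  - by move=> n; exact/measurable_EFinP/measurable_funP.
  - by move=> n y _; rewrite lee_fin.
  - by move=> y _ a b ab; rewrite lee_fin; exact/lefP/nd_nnsfun_approx.
rewrite [X in limn X](_ : _ =
    (fun n => \int[lebesgue_vec R d]_x ((f x)%:E * (h_ n x)%:E))%E); last first.
  apply/funext => n.
  rewrite integralT_nnsfun sintegralE.
  under [RHS]eq_integral => x _.
    rewrite fimfunE -fsumEFin// ge0_mule_fsumr; last first.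
      by move=> r; rewrite EFinM nnfun_muleindic_ge0.
    over.
  rewrite ge0_integral_fsum//; last 2 first.
  - move=> r; apply: emeasurable_funM => //.
    by apply/measurable_EFinP; apply: measurable_funM => //.
  - by move=> r x _; rewrite mule_ge0// EFinM nnfun_muleindic_ge0.
  apply: eq_fsbigr => r _.
  have [r0|r0] := leP 0 r; last first.
    rewrite preimage_nnfun0// measure0 mule0.
    by under eq_integral do rewrite indic0 mulr0 mule0; rewrite integral0.
  under [RHS]eq_integral => x _ do rewrite EFinM muleCA.
  rewrite ge0_integralZl//; last 2 first.
  - by apply: emeasurable_funM => //; exact/measurable_EFinP.
  - by move=> x _; rewrite mule_ge0// lee_fin.
  congr (_ * _)%E.
  rewrite /= /density_prob [LHS]integral_mkcond; apply: eq_integral => x _.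
  rewrite patchE indicE; case: ifPn => _; rewrite ?mule1 ?mule0//.
rewrite -monotone_convergence//.
- apply: eq_integral => x _; apply/cvg_lim => //.
  by apply: cvgeZl => //; exact: h_h.
- move=> n; apply: emeasurable_funM => //.
  exact/measurable_EFinP/measurable_funP.
- by move=> n y _; rewrite mule_ge0// lee_fin.
- move=> y _ a b ab; apply: lee_wpmul2l => //.
  by rewrite lee_fin; exact/lefP/nd_nnsfun_approx.
Qed.

(** The likelihood is the density of the sample with respect to the product of the
    Lebesgue measures; all vertices of the hypercube are compared under this common
    reference measure. *)
Lemma ge0_integral_iid_law f n (h : n.-tuple (Rvec R d) -> \bar R) :
  measurable_fun setT h -> (forall x, 0 <= h x)%E ->
  (\int[iid_law f n]_X h X =
   \int[tuple_measure (lebesgue_vec R d) n]_X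
     ((\prod_(i < n) f (tnth X i))%:E * h X))%E.
Proof.
move=> + h0; elim: n h h0 => [|n IH] h h0 mh.
  by rewrite /=; apply: eq_integral => X _; rewrite big_ord0 mul1e.
have mf := @measurable_density _ _ f.
rewrite [LHS]ge0_integral_tuple_measureS// ge0_integral_tuple_measureS; last 2 first.
- apply: emeasurable_funM => //; apply/measurable_EFinP.
  by apply: (measurable_prod_tnth (F := fun=> f)).
- by move=> X; rewrite mule_ge0// lee_fin prodr_ge0// => i _; rewrite density_ge0.
have mht x : measurable_fun setT (fun X : n.-tuple (Rvec R d) => h (tcons (x, X))).
  apply: (measurableT_comp mh); apply: (measurableT_comp (@measurable_tcons _ _ n)).
  exact: measurable_fun_pair.
have f0 x : 0 <= f x by exact: density_ge0.
rewrite ge0_integral_density_prob.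
- apply: eq_integral => x _; rewrite [X in (_ * X)%E]IH//.
  rewrite -ge0_integralZl//; last 3 first.
  + apply: emeasurable_funM => //; apply/measurable_EFinP.
    by apply: (measurable_prod_tnth (F := fun=> f)).
  + by move=> X _; rewrite mule_ge0// lee_fin prodr_ge0.
  + by rewrite lee_fin.
  apply: eq_integral => X _; rewrite muleA -EFinM.
  by rewrite (prod_tcons (fun=> f)).
- apply: (@measurable_fun_fubini_tonelli_F _ _ _ _ _ (tuple_measure (density_prob f) n)
    (fun z => h (tcons z))) => //.
  exact: (measurableT_comp mh (@measurable_tcons _ _ n)).
- by move=> x; apply: integral_ge0.
Qed.

End density_integration.

(** * Gaussian functions and their polynomial moments *)

Section gaussian.
Context {R : realType}.
Implicit Types (a m e nu x : R) (p q : {poly R}).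
Local Notation mu := (@lebesgue_measure R).

Definition gfun a m x : R := expR (- (a * (x - m) ^+ 2)).
(** The mass sqrt (pi / a) of [gfun a m], in the form that makes [gfun a m] this
    multiple of the normal density of variance (2 * a)^-1. *)
Definition gmass a : R := (normal_peak (Num.sqrt ((2 * a)^-1)))^-1.

Lemma gfun_gt0 a m x : 0 < gfun a m x. Proof. exact: expR_gt0. Qed.
Lemma gfun_ge0 a m x : 0 <= gfun a m x. Proof. exact: expR_ge0. Qed.

Lemma sqrt_half_inv_neq0 a : 0 < a -> Num.sqrt ((2 * a)^-1) != 0.
Proof. by move=> a0; rewrite gt_eqF// sqrtr_gt0 invr_gt0 mulr_gt0. Qed.

Lemma gmass_gt0 a : 0 < a -> 0 < gmass a.
Proof. by move=> a0; rewrite invr_gt0 normal_peak_gt0 ?sqrt_half_inv_neq0. Qed.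

Lemma gfunE a m x : 0 < a ->
  gfun a m x = gmass a * normal_pdf m (Num.sqrt ((2 * a)^-1)) x.
Proof.
move=> a0; rewrite normal_pdfE ?sqrt_half_inv_neq0// mulrA.
rewrite mulVf ?mul1r; last by rewrite gt_eqF// normal_peak_gt0 ?sqrt_half_inv_neq0.
rewrite /normal_fun sqr_sqrtr ?invr_ge0 ?mulr_ge0 ?(ltW a0)//.
congr expR; rewrite mulNr; congr (- _); field.
by rewrite gt_eqF.
Qed.

Lemma gfun_EFinE a m : 0 < a -> EFin \o gfun a m =
  (fun x => (gmass a)%:E * (normal_pdf m (Num.sqrt ((2 * a)^-1)) x)%:E)%E.
Proof. by move=> a0; apply/funext => x /=; rewrite gfunE. Qed.

Lemma integrable_gfun a m : 0 < a -> mu.-integrable setT (EFin \o gfun a m).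
Proof.
move=> a0; rewrite gfun_EFinE//; apply: integrableZl => //.
exact: integrable_normal_pdf.
Qed.

Lemma Rintegral_gfun a m : 0 < a -> \int[mu]_x gfun a m x = gmass a.
Proof.
move=> a0; rewrite /Rintegral -/(EFin \o gfun a m) gfun_EFinE//.
rewrite integralZl//; last exact: integrable_normal_pdf.
by rewrite integral_normal_pdf mule1.
Qed.

Lemma continuous_gfun a m : continuous (gfun a m).
Proof.
move=> x; apply: continuous_comp; last exact: continuous_expR.
apply: continuousN; apply: continuousM; first exact: cvg_cst.
apply: (@continuous_comp _ _ _ (fun x => x - m) (fun y => y ^+ 2)).
  by apply: continuousB; [exact: cvg_id|exact: cvg_cst].
exact: exprn_continuous.
Qed.

Lemma measurable_gfun a m : measurable_fun setT (gfun a m).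
Proof. by apply: continuous_measurable_fun; exact: continuous_gfun. Qed.

Lemma exprn_le_expR n x e : 0 < e -> 0 <= x ->
  x ^+ n <= n`!%:R * e^-1 ^+ n * expR (e * x).
Proof.
move=> e0 x0.
have ex0 : 0 <= e * x by rewrite mulr_ge0// ltW.
have -> : x ^+ n = (e * x) ^+ n * e^-1 ^+ n.
  by rewrite -exprMn mulrAC divff ?mul1r// gt_eqF.
rewrite [leRHS]mulrAC ler_wpM2r ?exprn_ge0 ?invr_ge0 ?(ltW e0)//.
case: n => [|n]; first by rewrite expr0 fact0 mul1r -expR0 ler_expR.
rewrite [leRHS]mulrC -ler_pdivrMr ?ltr0n ?fact_gt0//.
by apply: le_trans (expR_ge1Dxn n ex0); rewrite lerDr.
Qed.

(** By Horner's scheme, halving the exponent at each multiplication by the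
    variable. *)
Lemma horner_le_expR p e m : 0 < e ->
  exists C, forall x, `|p.[x]| <= C * expR (e * (x - m) ^+ 2).
Proof.
elim/poly_ind: p e => [|p c IH] e e0.
  by exists 0 => x; rewrite horner0 normr0 mul0r.
have e20 : 0 < e / 2 by rewrite divr_gt0.
have [C HC] := IH _ e20.
have C0 : 0 <= C.
  by have := le_trans (normr_ge0 _) (HC 0); rewrite pmulr_lge0// expR_gt0.
exists (C * (`|m| + 1 + (e / 2)^-1) + `|c|) => x.
rewrite hornerMXaddC.
set s := (x - m) ^+ 2; have s0 : 0 <= s by exact: sqr_ge0.
have E1 : 1 <= expR (e / 2 * s) by rewrite -[leLHS]expR0 ler_expR mulr_ge0 ?(ltW e20).
have Es : s <= (e / 2)^-1 * expR (e / 2 * s).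
  by have := exprn_le_expR 1 e20 s0; rewrite !expr1 mul1r.
have EE : expR (e * s) = expR (e / 2 * s) * expR (e / 2 * s).
  by rewrite -expRD -mulrDl -splitr.
have xb : `|x| <= (`|m| + 1 + (e / 2)^-1) * expR (e / 2 * s).
  have -> : x = m + (x - m) by rewrite addrC subrK.
  apply: (le_trans (ler_normD _ _)).
  rewrite !mulrDl mul1r -addrA lerD//; first by rewrite ler_peMr.
  have : `|x - m| <= 1 + s.
    have -> : s = `|x - m| ^+ 2 by rewrite real_normK ?num_real.
    have := sqr_ge0 (`|x - m| - 1 / 2); nra.
  by move=> /le_trans; apply; exact: lerD.
apply: (le_trans (ler_normD _ _)); rewrite [leRHS]mulrDl lerD//.
  rewrite normrM EE mulrACA; apply: ler_pM => //.
by rewrite ler_peMr// EE mulr_ege1.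
Qed.

Lemma horner_gfun_le p a m : 0 < a ->
  exists C, forall x, `|p.[x] * gfun a m x| <= C * gfun (a / 2) m x.
Proof.
move=> a0; have a20 : 0 < a / 2 by rewrite divr_gt0.
have [C HC] := horner_le_expR p m a20; exists C => x.
rewrite normrM (ger0_norm (gfun_ge0 _ _ _)).
have -> : gfun (a / 2) m x = expR (a / 2 * (x - m) ^+ 2) * gfun a m x.
  by rewrite -expRD; congr expR; field.
by rewrite mulrA ler_wpM2r// gfun_ge0.
Qed.

Lemma measurable_horner p : measurable_fun setT (horner p).
Proof. by apply: continuous_measurable_fun; exact: continuous_horner. Qed.

Lemma measurable_horner_gfun p a m :
  measurable_fun setT (fun x => p.[x] * gfun a m x).
Proof. exact: measurable_funM (measurable_horner p) (measurable_gfun a m). Qed.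

Lemma integrable_horner_gfun p a m : 0 < a ->
  mu.-integrable setT (EFin \o (fun x => p.[x] * gfun a m x)).
Proof.
move=> a0; have [C HC] := horner_gfun_le p m a0.
have a20 : 0 < a / 2 by rewrite divr_gt0.
apply: (@le_integrable _ _ _ mu _ measurableT _
    (EFin \o (fun x => C * gfun (a / 2) m x))).
- by apply/measurable_EFinP; exact: measurable_horner_gfun.
- move=> x _ /=; rewrite lee_fin; apply: (le_trans (HC x)); exact: ler_norm.
- exact: (integrableZl measurableT C (integrable_gfun m a20)).
Qed.

Definition gmoment a m p := \int[mu]_x (p.[x] * gfun a m x).

Lemma gmomentD a m p q : 0 < a -> gmoment a m (p + q) = gmoment a m p + gmoment a m q.
Proof.
move=> a0; rewrite /gmoment -RintegralD//; try exact: integrable_horner_gfun.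
by apply: eq_Rintegral => x _; rewrite hornerD mulrDl.
Qed.

Lemma gmomentZ a m c p : 0 < a -> gmoment a m (c *: p) = c * gmoment a m p.
Proof.
move=> a0; rewrite /gmoment -RintegralZl//; last exact: integrable_horner_gfun.
by apply: eq_Rintegral => x _; rewrite hornerZ mulrA.
Qed.

Lemma gmoment1 a m : 0 < a -> gmoment a m 1 = gmass a.
Proof.
move=> a0; rewrite /gmoment -(Rintegral_gfun m a0).
by apply: eq_Rintegral => x _; rewrite hornerC mul1r.
Qed.

End gaussian.

(** * Gaussian integration by parts *)

Section stein.
Context {R : realType}.
Implicit Types (a m e nu x : R) (p q : {poly R}).
Local Notation mu := (@lebesgue_measure R).

(* q is the polynomial with (p * gfun a m)' = q * gfun a m *)
Let q a m p := p^`() - (2 * a) *: (('X - m%:P) * p).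

Lemma is_derive_horner p x : is_derive x 1 (horner p) (p^`()).[x].
Proof.
apply: DeriveDef; first exact: derivable_horner.
by rewrite -derive1E -derivE.
Qed.

Lemma is_derive_horner_gfun a m p x :
  is_derive x 1 (fun x => p.[x] * gfun a m x) ((q a m p).[x] * gfun a m x).
Proof.
pose r : {poly R} := - (a *: ('X - m%:P) ^+ 2).
have gr : gfun a m = expR \o horner r.
  by apply/funext => y; rewrite /= /gfun /r !hornerE.
have dg : is_derive x 1 (gfun a m) (gfun a m x * (- (2 * a * (x - m)))).
  rewrite gr (_ : - _ = (r^`()).[x]); last first.
    by rewrite /r derivN derivZ expr2 derivM derivXsubC !hornerE/=; ring.
  exact: is_derive1_comp.
have -> : (q a m p).[x] * gfun a m x =
    p.[x] *: (gfun a m x * (- (2 * a * (x - m)))) + gfun a m x *: (p^`()).[x].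
  by rewrite /q !hornerE/= /GRing.scale/=; ring.
exact: (is_deriveM (is_derive_horner p x) dg).
Qed.

Let F a m p x := p.[x] * gfun a m x.

Lemma continuous_horner_gfun p a m : continuous (fun x => p.[x] * gfun a m x).
Proof.
by move=> x; apply: continuousM; [exact: continuous_horner|exact: continuous_gfun].
Qed.

Let D (n : nat) : set R := `[- n.+1%:R, n.+1%:R]%classic.

Let integral_itv_derive a m p (n : nat) :
  (\int[mu]_(x in D n) ((q a m p).[x] * gfun a m x)%:E =
    (F a m p n.+1%:R - F a m p (- n.+1%:R))%:E)%E.
Proof.
have dF x := is_derive_horner_gfun a m p x.
rewrite EFinB; apply: (@continuous_FTC2 _ (F a m (q a m p)) (F a m p)).
- by rewrite (@lt_trans _ _ 0)// ?oppr_lt0 ltr0n.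
- by apply: continuous_subspaceT => x; exact: continuous_horner_gfun.
- split => [x _||].
  + by have [] := dF x.
  + by apply: cvg_at_right_filter; exact: continuous_horner_gfun.
  + by apply: cvg_at_left_filter; exact: continuous_horner_gfun.
- by move=> x _; rewrite derive1E; have [_ ->] := dF x.
Qed.

Let boundary_cvg0 a m p : 0 < a ->
  (fun n : nat => F a m p n.+1%:R - F a m p (- n.+1%:R)) @ \oo --> (0 : R).
Proof.
(* bounding 'X * p instead of p gives a decay of order 1 / |x| *)
move=> a0; have [C HC] := horner_gfun_le ('X * p) m a0.
have C0 : 0 <= C.
  by have := le_trans (normr_ge0 _) (HC 0); rewrite pmulr_lge0// gfun_gt0.
have b x (n : nat) : `|x| = n.+1%:R -> `|F a m p x| <= C * harmonic n.
  move=> xn; have n0 : 0 < n.+1%:R :> R by rewrite ltr0n.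
  rewrite /harmonic/= ler_pdivlMr// -xn -normrM.
  have -> : F a m p x * x = ('X * p).[x] * gfun a m x.
    by rewrite hornerM hornerX /F; ring.
  apply: (le_trans (HC x)); rewrite ler_piMr// -expR0 ler_expR oppr_le0.
  by rewrite mulr_ge0 ?sqr_ge0// divr_ge0// ltW.
apply: (@squeeze_cvgr _ _ _ _ (fun n => - (C * harmonic n + C * harmonic n)) (fun n => C * harmonic n + C * harmonic n)).
- apply: nearW => n; rewrite -ler_norml (le_trans (ler_normB _ _))// lerD// b//.
    by rewrite ger0_norm.
  by rewrite normrN ger0_norm.
- rewrite -[X in _ --> X]oppr0; apply: cvgN.
  rewrite -(addr0 (0 : R)) -(mulr0 C); apply: cvgD; apply: cvgMr; exact: cvg_harmonic.
- rewrite -[X in _ --> X](addr0 (0 : R)) -(mulr0 C); apply: cvgD; apply: cvgMr; exact: cvg_harmonic.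
Qed.

(** The integrand is the derivative of a function vanishing at infinity.  The
    integral over [- n - 1, n + 1] is a difference of boundary terms that tends to
    0, and it converges to the full integral by dominated convergence. *)
Lemma gmoment_derive_eq0 a m p : 0 < a ->
  gmoment a m (p^`() - (2 * a) *: (('X - m%:P) * p)) = 0.
Proof.
move=> a0; rewrite -/(q a m p) /gmoment.
set f := fun x => (q a m p).[x] * gfun a m x.
have intf : mu.-integrable setT (EFin \o f) by exact: integrable_horner_gfun.
have mf : measurable_fun setT (EFin \o f) := measurable_int _ intf.
have fD : (fun n => \int[mu]_x ((EFin \o f) \_ (D n)) x)%E @ \oo --> (\int[mu]_x (f x)%:E)%E.
  have [] := @dominated_convergence _ _ _ mu setT measurableT
    (fun n => (EFin \o f) \_ (D n)) (EFin \o f) (abse \o (EFin \o f)).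
  - move=> n; apply/(measurable_restrictT (EFin \o f)); first exact: measurable_itv.
    exact: measurable_funTS.
  - exact: mf.
  - apply/aeW => x _; apply: cvg_near_cst.
    exists (Num.bound `|x|) => // n /= xn.
    rewrite patchE mem_set// /D/= in_itv/= -ler_norml.
    apply: (le_trans (ltW (archi_boundP (normr_ge0 x)))); rewrite ler_nat.
    exact: leq_trans xn (leqnSn n).
  - exact: integrable_abse.
  - apply/aeW => x n _; rewrite patchE; case: ifP => _ /=; first exact: lexx.
    by rewrite normr0 lee_fin normr_ge0.
  - by [].
have {fD} : (fun n => (F a m p n.+1%:R - F a m p (- n.+1%:R))%:E) @ \oo --> (\int[mu]_x (f x)%:E)%E.
  apply: cvg_trans fD; apply: near_eq_cvg; apply: nearW => n.
  by rewrite -integral_itv_derive [RHS]integral_mkcond.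
rewrite -[X in _ --> X]fineK; last exact: integrable_fin_num.
move/fine_cvg => /= H; rewrite /Rintegral.
exact: (cvg_unique _ H (boundary_cvg0 m p a0)).
Qed.

(** Stein's identity for the normal law of mean m and variance (2 * a)^-1. *)
Lemma gmoment_stein a m p : 0 < a ->
  gmoment a m (('X - m%:P) * p) = (2 * a)^-1 * gmoment a m p^`().
Proof.
move=> a0; have := gmoment_derive_eq0 m p a0.
rewrite gmomentD// -scaleNr gmomentZ// mulNr => /eqP.
rewrite subr_eq0 => /eqP ->; rewrite mulKf//.
by rewrite gt_eqF// mulr_gt0.
Qed.

End stein.

(** * Hermite polynomials *)

Section hermite.
Context {R : realType}.
Implicit Types (a c m e nu x : R) (p q : {poly R}).

(** For nu > 0 these are the monic orthogonal polynomials of the centred normal law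
    of variance nu.  The recurrence makes sense for every nu, and smaller, possibly
    negative values arise by averaging, see [gmoment_herm]. *)
Fixpoint herm nu n : {poly R} :=
  if n is n1.+1 then
    'X * herm nu n1 - (if n1 is n2.+1 then (nu * n1%:R) *: herm nu n2 else 0)
  else 1.

Lemma hermSS nu n :
  herm nu n.+2 = 'X * herm nu n.+1 - (nu * n.+1%:R) *: herm nu n.
Proof. by []. Qed.

Lemma herm1 nu : herm nu 1 = 'X.
Proof. by rewrite /= mulr1 subr0. Qed.

Lemma nat_ind2 (P : nat -> Prop) :
  P 0%N -> P 1%N -> (forall n, P n -> P n.+1 -> P n.+2) -> forall n, P n.
Proof.
move=> P0 P1 PSS n; suff [] : P n /\ P n.+1 by [].
by elim: n => [//|n [Pn PSn]]; split => //; exact: PSS.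
Qed.

Lemma deriv_herm nu n : (herm nu n.+1)^`() = n.+1%:R *: herm nu n.
Proof.
elim/nat_ind2: n => [||n IH0 IH1]; first by rewrite herm1 derivX scale1r.
  rewrite hermSS herm1 derivB derivM derivX derivZ derivC scaler0 subr0.
  by rewrite mul1r mulr1 scaler_nat mulr2n.
rewrite hermSS derivB derivM derivX derivZ mul1r IH0 IH1.
rewrite hermSS -[n.+3%:R]natr1 -!mul_polyC !polyCM !polyCD !polyC1.
ring.
Qed.

Lemma herm_odd0 nu n : (herm nu n.*2.+1).[0] = 0.
Proof.
elim: n => [|n IH]; first by rewrite herm1 hornerX.
by rewrite doubleS hermSS hornerD hornerN hornerZ hornerM hornerX IH mul0r mulr0 subr0.
Qed.

Lemma herm_scale nu c n x : (herm (c ^+ 2 * nu) n).[c * x] = c ^+ n * (herm nu n).[x].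
Proof.
elim/nat_ind2: n => [||n IH0 IH1]; first by rewrite !hornerE.
  by rewrite !herm1 !hornerX.
rewrite !hermSS; move: IH0 IH1; move: (herm _ n.+1) (herm _ n) => p q.
move: (herm _ n.+1) (herm _ n) => p' q'; rewrite !hornerE => -> ->.
by rewrite !exprS; ring.
Qed.

(** Averaging against a normal law lowers the parameter by its variance, as the
    generating function exp (x * t - nu * t ^ 2 / 2) suggests.  Stein's identity
    shows that both sides satisfy the same three-term recurrence. *)
Lemma gmoment_herm a m nu n : 0 < a ->
  gmoment a m (herm nu n) = gmass a * (herm (nu - (2 * a)^-1) n).[m].
Proof.
move=> a0.
have MX p : gmoment a m ('X * p) = (2 * a)^-1 * gmoment a m p^`() + m * gmoment a m p.
  rewrite -gmoment_stein// -gmomentZ// -gmomentD// -mul_polyC -mulrDl.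
  by rewrite subrK.
elim/nat_ind2: n => [||n IH0 IH1].
- by rewrite /= gmoment1// hornerC mulr1.
- rewrite !herm1 -[X in gmoment _ _ X]mulr1 MX gmoment1// hornerX derivC.
  by rewrite -(scale0r 0) gmomentZ// mul0r mulr0 add0r mulrC.
- rewrite !hermSS -scaleNr gmomentD// gmomentZ// MX deriv_herm gmomentZ// IH0 IH1.
  move: (herm _ n.+1) (herm _ n) => p q; rewrite hornerD hornerN hornerZ hornerM hornerX; ring.
Qed.

(** When nu is the variance, Stein's identity moves one factor 'X - nu * d/dx off the
    left polynomial and differentiates the right one, which lowers both degrees. *)
Lemma gmoment_herm_mul a i j : 0 < a ->
  gmoment a 0 (herm (2 * a)^-1 i * herm (2 * a)^-1 j) =
  gmass a * ((2 * a)^-1 ^+ i * i`!%:R) *+ (i == j).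
Proof.
move=> a0; set v := (2 * a)^-1.
have M0 n : gmoment a 0 (herm v n.+1) = 0.
  rewrite gmoment_herm// subrr.
  elim/nat_ind2: n => [||n IH0 _].
  - by rewrite herm1 hornerX mulr0.
  - by rewrite hermSS herm1 !hornerE; ring.
  - by rewrite hermSS mul0r scale0r subr0 hornerM hornerX mul0r mulr0.
have MS p n : gmoment a 0 (herm v n.+1 * p) = v * gmoment a 0 (herm v n * p^`()).
  have MX r : gmoment a 0 ('X * r) = v * gmoment a 0 r^`().
    by rewrite -gmoment_stein// subr0.
  case: n => [|n]; first by rewrite herm1 MX mul1r.
  rewrite hermSS mulrBl -scalerAl -scaleNr gmomentD// gmomentZ// -mulrA MX.
  rewrite derivM deriv_herm gmomentD// -scalerAl gmomentZ//; ring.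
elim: i j => [|i IH] [|j].
- by rewrite mul1r gmoment1// expr0 fact0 !mulr1.
- by rewrite mul1r M0.
- by rewrite mulr1 M0.
rewrite MS deriv_herm -scalerAr gmomentZ// IH eqSS.
case: eqP => [->|_]; last by rewrite !mulr0n !mulr0.
by rewrite !mulr1n factS natrM exprS; ring.
Qed.

(** The recurrence gives |H_k(x)| <= (|x| + s) ^ k by induction as long as k is at
    most s ^ 2. *)
Lemma herm_bound nu n x : 0 <= nu <= 1 ->
  `|(herm nu n).[x]| <= (`|x| + Num.sqrt n%:R) ^+ n.
Proof.
move=> /andP[nu0 nu1]; set s := Num.sqrt _.
have s0 : 0 <= s by exact: sqrtr_ge0.
have s2 : s ^+ 2 = n%:R by rewrite sqr_sqrtr.
suff H k : (k <= n)%N -> `|(herm nu k).[x]| <= (`|x| + s) ^+ k by exact: H.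
elim/nat_ind2: k => [_|_|k IH0 IH1 kn].
- by rewrite hornerC normr1.
- by rewrite herm1 hornerX expr1 lerDl.
have {IH0} := IH0 (ltnW (ltnW kn)); have {IH1} := IH1 (ltnW kn).
rewrite hermSS; move: (herm _ k.+1) (herm _ k) => p q hp hq.
rewrite !hornerE (le_trans (ler_normB _ _))// !normrM.
rewrite (ger0_norm nu0) (ger0_norm (ler0n _ _)) !exprS.
rewrite exprS in hp.
set y := (`|x| + s) ^+ k in hp hq *.
have y0 : 0 <= y by rewrite exprn_ge0 ?addr_ge0.
have x0 := normr_ge0 x.
have ks : k.+1%:R <= s ^+ 2 by rewrite s2 ler_nat ltnW.
have : `|x| * `|p.[x]| <= `|x| * ((`|x| + s) * y) by rewrite ler_wpM2l.
have : nu * k.+1%:R * `|q.[x]| <= s ^+ 2 * y.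
  apply: ler_pM => //; first by rewrite mulr_ge0.
  by apply: le_trans ks; rewrite ler_piMl.
have : 0 <= `|x| * s * y by rewrite !mulr_ge0.
rewrite !expr2; nra.
Qed.

(** The factorial is exactly the growth of the norm of the polynomial, so after
    normalization only the geometric factor is left. *)
Lemma herm_sqr_bound nu n x e : 0 <= nu <= 1 -> 0 < e ->
  (herm nu n).[x] ^+ 2 <= n`!%:R * (expR e * (2 / e)) ^+ n * expR (e * x ^+ 2).
Proof.
move=> nu1 e0; set s := Num.sqrt (n%:R : R).
have s0 : 0 <= s by exact: sqrtr_ge0.
have s2 : s ^+ 2 = n%:R by rewrite sqr_sqrtr.
rewrite -[leLHS]real_normK ?num_real//.
apply: (@le_trans _ _ ((2 * x ^+ 2 + 2 * s ^+ 2) ^+ n)).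
  apply: (@le_trans _ _ (((`|x| + s) ^+ n) ^+ 2)).
    by rewrite lerXn2r ?nnegrE ?exprn_ge0 ?addr_ge0// herm_bound.
  rewrite -exprM mulnC exprM lerXn2r ?nnegrE ?exprn_ge0 ?addr_ge0//.
    by rewrite mulr_ge0 // sqr_ge0.
  by rewrite mulr_ge0 // sqr_ge0.
  rewrite -(real_normK (num_real x)).
  have := sqr_ge0 (`|x| - s); rewrite !expr2; nra.
have e20 : 0 < e / 2 by rewrite divr_gt0.
apply: (le_trans (exprn_le_expR n e20 _)).
  by rewrite addr_ge0// mulr_ge0// sqr_ge0.
rewrite s2 invf_div (exprMn _ (expR e)) -expRM_natl -!mulrA ler_wpM2l//.
rewrite [leRHS]mulrCA ler_wpM2l ?exprn_ge0 ?divr_ge0 ?(ltW e0)//.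
by rewrite -expRD ler_expR; lra.
Qed.

End hermite.

(** * The one-dimensional perturbations *)

Lemma integrable_EFinZl d (T : measurableType d) (R : realType)
    (m : {measure set T -> \bar R}) (c : R) (f : T -> R) :
  m.-integrable setT (EFin \o f) ->
  m.-integrable setT (EFin \o (fun x => c * f x)).
Proof. exact: (integrableZl measurableT c). Qed.

Section bumps.
Context {R : realType}.
Implicit Types (u x : R) (j k n : nat).
Local Notation mu := (@lebesgue_measure R).
Local Notation pk := (@normal_peak R 1).

Definition base_mix u : R := gfun (1 / 4) 0 u / gmass (1 / 4).

Definition base_obs x : R :=
  pk * gmass (3 / 4) / gmass (1 / 4) * gfun (1 / 6) 0 x.

(** The norm in L^2(1 / base_obs) of the image, under convolution with phi, of
    [herm (7 / 8) n] times [gfun (1 / 2) 0]. *)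
Definition bump_norm n : R := Num.sqrt
  (pk * gmass 1 ^+ 2 * gmass (1 / 4) / gmass (3 / 4) * gmass (1 / 3) *
     ((3 / 8) ^+ n * n`!%:R)).

(** Odd degrees are used because the total mass must vanish.  The parameter 7 / 8 is
    forced: as a function of u, the product of exp (- (x - u) ^ 2 / 2) and
    exp (- u ^ 2 / 2) is normal of mean x / 2 and variance 1 / 2, so that averaging
    produces [herm (7 / 8 - 1 / 2)] at x / 2.  By [herm_scale] this is a multiple of
    [herm (3 / 2)] at x, and 3 / 2 is the variance of the weight
    exp (- x ^ 2 / 3), the ratio of exp (- x ^ 2 / 4) ^ 2 to exp (- x ^ 2 / 6) in
    [base_obs]. *)
Definition bump_mix j u : R :=
  (herm (7 / 8) j.*2.+1).[u] * gfun (1 / 2) 0 u / bump_norm j.*2.+1.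

Definition bump_obs j x : R :=
  pk * gmass 1 * 2^-1 ^+ j.*2.+1 * (herm (3 / 2) j.*2.+1).[x] *
    gfun (1 / 4) 0 x / bump_norm j.*2.+1.

Let pk0 : 0 < pk. Proof. by rewrite normal_peak_gt0 ?oner_neq0. Qed.

Let bump_norm_arg_gt0 n : 0 < pk * gmass 1 ^+ 2 * gmass (1 / 4) / gmass (3 / 4) *
    gmass (1 / 3) * ((3 / 8) ^+ n * n`!%:R).
Proof.
by rewrite !(pk0, mulr_gt0, divr_gt0, exprn_gt0, gmass_gt0, invr_gt0)//.
Qed.

Lemma bump_norm_gt0 n : 0 < bump_norm n.
Proof. by rewrite sqrtr_gt0. Qed.

Lemma base_mix_gt0 u : 0 < base_mix u.
Proof. by rewrite divr_gt0 ?gfun_gt0 ?gmass_gt0 ?divr_gt0. Qed.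

Lemma base_obs_gt0 x : 0 < base_obs x.
Proof.
by rewrite !(pk0, mulr_gt0, divr_gt0, gfun_gt0, gmass_gt0, invr_gt0).
Qed.

Lemma integrable_base_mix : mu.-integrable setT (EFin \o base_mix).
Proof.
rewrite (_ : base_mix = (fun u => (gmass (1 / 4))^-1 * gfun (1 / 4) 0 u)).
  apply: integrable_EFinZl; apply: integrable_gfun; lra.
by apply/funext => u; rewrite mulrC.
Qed.

Lemma integrable_bump_mix j : mu.-integrable setT (EFin \o bump_mix j).
Proof.
rewrite (_ : bump_mix j = (fun u => (bump_norm j.*2.+1)^-1 *
    ((herm (7 / 8) j.*2.+1).[u] * gfun (1 / 2) 0 u))).
  apply: integrable_EFinZl; apply: integrable_horner_gfun; lra.
by apply/funext => u; rewrite mulrC.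
Qed.

Lemma Rintegral_base_mix : \int[mu]_u base_mix u = 1.
Proof.
have h : 0 < 1 / 4 :> R by lra.
rewrite /base_mix RintegralZr//; last exact: integrable_gfun.
by rewrite Rintegral_gfun// divff// gt_eqF// gmass_gt0.
Qed.

Lemma Rintegral_bump_mix j : \int[mu]_u bump_mix j u = 0.
Proof.
have h : 0 < 1 / 2 :> R by lra.
rewrite /bump_mix RintegralZr//; last exact: integrable_horner_gfun.
by rewrite -/(gmoment _ _ _) gmoment_herm// herm_odd0 mulr0 mul0r.
Qed.

Lemma normal_pdf_gfun x u : normal_pdf 0 1 (x - u) = pk * gfun (1 / 2) x u.
Proof.
rewrite normal_pdfE ?oner_neq0//; congr (_ * _).
by rewrite /normal_fun /gfun; congr expR; field.
Qed.

Lemma normal_pdf_base_mix x u : normal_pdf 0 1 (x - u) * base_mix u =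
  pk / gmass (1 / 4) * gfun (1 / 6) 0 x * gfun (3 / 4) (2 / 3 * x) u.
Proof.
rewrite normal_pdf_gfun /base_mix -[RHS]mulrA.
have -> : gfun (1 / 6) 0 x * gfun (3 / 4) (2 / 3 * x) u =
   gfun (1 / 2) x u * gfun (1 / 4) 0 u; last by ring.
by rewrite -!expRD; congr expR; field.
Qed.

Lemma normal_pdf_bump_mix j x u : normal_pdf 0 1 (x - u) * bump_mix j u =
  pk / bump_norm j.*2.+1 * gfun (1 / 4) 0 x *
    ((herm (7 / 8) j.*2.+1).[u] * gfun 1 (2^-1 * x) u).
Proof.
rewrite normal_pdf_gfun /bump_mix; set h := (_).[_].
have : gfun (1 / 4) 0 x * gfun 1 (2^-1 * x) u =
   gfun (1 / 2) x u * gfun (1 / 2) 0 u.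
  by rewrite -!expRD; congr expR; field.
move: (gfun _ _ u) => g E; rewrite -[RHS]mulrA [X in _ = _ * X]mulrCA E.
ring.
Qed.

Lemma integrable_conv_base_mix x :
  mu.-integrable setT (EFin \o (fun u => normal_pdf 0 1 (x - u) * base_mix u)).
Proof.
under eq_fun do rewrite normal_pdf_base_mix.
apply: integrable_EFinZl; apply: integrable_gfun; lra.
Qed.

Lemma integrable_conv_bump_mix j x :
  mu.-integrable setT (EFin \o (fun u => normal_pdf 0 1 (x - u) * bump_mix j u)).
Proof.
under eq_fun do rewrite normal_pdf_bump_mix.
apply: integrable_EFinZl; apply: integrable_horner_gfun; lra.
Qed.

Lemma conv_base_mix x :
  \int[mu]_u (normal_pdf 0 1 (x - u) * base_mix u) = base_obs x.
Proof.
have h : 0 < 3 / 4 :> R by lra.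
under eq_Rintegral do rewrite normal_pdf_base_mix.
rewrite RintegralZl//; last exact: integrable_gfun.
by rewrite Rintegral_gfun// /base_obs; ring.
Qed.

Lemma conv_bump_mix j x :
  \int[mu]_u (normal_pdf 0 1 (x - u) * bump_mix j u) = bump_obs j x.
Proof.
have h : 0 < 1 :> R by lra.
under eq_Rintegral do rewrite normal_pdf_bump_mix.
rewrite RintegralZl//; last exact: integrable_horner_gfun.
rewrite -/(gmoment _ _ _) gmoment_herm//.
rewrite (_ : 7 / 8 - (2 * 1)^-1 = 2^-1 ^+ 2 * (3 / 2)); last by field.
rewrite herm_scale /bump_obs; ring.
Qed.

Lemma bump_obs_mulE i j x : bump_obs i x * bump_obs j x / base_obs x =
  pk * gmass 1 ^+ 2 * gmass (1 / 4) / gmass (3 / 4) *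
  2^-1 ^+ i.*2.+1 * 2^-1 ^+ j.*2.+1 / bump_norm i.*2.+1 / bump_norm j.*2.+1 *
  ((herm (3 / 2) i.*2.+1 * herm (3 / 2) j.*2.+1).[x] * gfun (1 / 3) 0 x).
Proof.
have E : gfun (1 / 3) 0 x * gfun (1 / 6) 0 x = gfun (1 / 4) 0 x * gfun (1 / 4) 0 x.
  by rewrite -!expRD; congr expR; field.
rewrite hornerM /bump_obs /base_obs.
apply: (mulIf (x := gfun (1 / 6) 0 x)); first by rewrite gt_eqF// gfun_gt0.
rewrite -[RHS]mulrA -[X in _ = _ * X]mulrA E.
have := gfun_gt0 (1 / 6) 0 x; have := bump_norm_gt0 i.*2.+1.
have := bump_norm_gt0 j.*2.+1.
have : 0 < gmass (1 / 4) :> R by rewrite gmass_gt0//; lra.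
have : 0 < gmass (3 / 4) :> R by rewrite gmass_gt0//; lra.
move: (gfun _ _ _) (gfun _ _ _) (gmass _) (gmass _) (gmass _) (bump_norm _) (bump_norm _)
  => *; field.
by rewrite ?gt_eqF.
Qed.

Lemma integrable_bump_obs_mul i j : mu.-integrable setT
  (EFin \o (fun x => bump_obs i x * bump_obs j x / base_obs x)).
Proof.
under eq_fun do rewrite bump_obs_mulE.
apply: integrable_EFinZl; apply: integrable_horner_gfun; lra.
Qed.

Lemma Rintegral_bump_obs_mul i j :
  \int[mu]_x (bump_obs i x * bump_obs j x / base_obs x) = (i == j)%:R.
Proof.
have h : 0 < 1 / 3 :> R by lra.
under eq_Rintegral do rewrite bump_obs_mulE.
rewrite RintegralZl//; last exact: integrable_horner_gfun.
rewrite -/(gmoment _ _ _) (_ : 3 / 2 = (2 * (1 / 3))^-1); last by field.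
rewrite gmoment_herm_mul// eqSS (inj_eq double_inj).
case: eqP => [->|_]; last by rewrite mulr0n mulr0.
rewrite mulr1n.
have n0 := bump_norm_gt0 j.*2.+1.
apply: (mulIf (x := bump_norm j.*2.+1 ^+ 2)); first by rewrite gt_eqF ?exprn_gt0.
set n := j.*2.+1 in n0 *; rewrite /= [RHS]mul1r.
rewrite [RHS]sqr_sqrtr ?(ltW (bump_norm_arg_gt0 _))//.
have -> : (3 / 8 : R) ^+ n = 2^-1 ^+ n * 2^-1 ^+ n * (2 * (1 / 3))^-1 ^+ n.
  by rewrite -exprMn -exprMn; congr (_ ^+ n); field.
have : 0 < gmass (3 / 4) :> R by rewrite gmass_gt0//; lra.
move: n0; move: (gmass _) (gmass _) (gmass _) (gmass _) (bump_norm n) => *; field.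
by rewrite ?gt_eqF.
Qed.

(** [herm_sqr_bound] with e = 1 / 2 lets the polynomial grow like exp (u ^ 2 / 4),
    which is what separates exp (- u ^ 2 / 2) from exp (- u ^ 2 / 4) in [base_mix]. *)
Lemma bump_mix_le : exists2 B : R, 1 <= B &
  forall j u, `|bump_mix j u| <= B ^+ j.+1 * base_mix u.
Proof.
set c1 := pk * gmass 1 ^+ 2 * gmass (1 / 4) / gmass (3 / 4) * gmass (1 / 3).
have c10 : 0 < c1.
  by rewrite !(pk0, mulr_gt0, divr_gt0, exprn_gt0, gmass_gt0, invr_gt0).
set K : R := expR (1 / 2) * (2 / (1 / 2)).
have K0 : 0 < K by rewrite mulr_gt0 ?expR_gt0//; lra.
set L := Num.sqrt (K / (3 / 8)); have L0 : 0 <= L by exact: sqrtr_ge0.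
have L2 : L ^+ 2 = K / (3 / 8) by rewrite sqr_sqrtr ?divr_ge0 ?(ltW K0).
set M := gmass (1 / 4) / Num.sqrt c1.
have g0 : 0 < gmass (1 / 4) :> R by rewrite gmass_gt0//; lra.
have M0 : 0 <= M by rewrite divr_ge0 ?sqrtr_ge0// ltW.
(* M * L ^ (2 * j + 1) <= ((1 + M) * (1 + L) ^ 2) ^ (j + 1) *)
exists ((1 + M) * (1 + L) ^+ 2) => [|j u].
  by rewrite mulr_ege1 ?exprn_ege1 ?lerDl.
set n := j.*2.+1.
apply: (@le_trans _ _ (M * L ^+ n * base_mix u)); last first.
  rewrite ler_wpM2r ?(ltW (base_mix_gt0 u))// exprMn ler_pM ?exprn_ge0//.
    by rewrite (@le_trans _ _ (1 + M)) ?lerDr// ler_eXnr// lerDl.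
  rewrite -exprM (@le_trans _ _ ((1 + L) ^+ n))//.
    by rewrite lerXn2r ?nnegrE ?addr_ge0 ?lerDr.
  by rewrite ler_weXn2l ?lerDl// mul2n doubleS.
rewrite /bump_mix -/n normrM normrM (gtr0_norm (gfun_gt0 _ _ _)).
rewrite normfV (gtr0_norm (bump_norm_gt0 _)).
rewrite ler_pdivrMr ?bump_norm_gt0//.
have gE : gfun (1 / 2) 0 u = gfun (1 / 4) 0 u * gfun (1 / 4) 0 u.
  by rewrite -expRD; congr expR; field.
have -> : M * L ^+ n * base_mix u * bump_norm n =
    L ^+ n * Num.sqrt ((3 / 8) ^+ n * n`!%:R) * gfun (1 / 4) 0 u.
  have -> : bump_norm n = Num.sqrt c1 * Num.sqrt ((3 / 8) ^+ n * n`!%:R).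
    by rewrite -sqrtrM ?(ltW c10).
  rewrite /M /base_mix; have : 0 < Num.sqrt c1 by rewrite sqrtr_gt0.
  move: g0; move: (gmass _) (Num.sqrt c1) => *; field.
  by rewrite ?gt_eqF.
rewrite gE mulrA ler_wpM2r ?gfun_ge0//.
rewrite -(ler_pXn2r (n := 2)) ?nnegrE ?mulr_ge0 ?gfun_ge0 ?exprn_ge0 ?sqrtr_ge0//.
rewrite !(exprMn 2) sqr_sqrtr; last by rewrite mulr_ge0 ?exprn_ge0 ?divr_ge0.
rewrite real_normK ?num_real//.
have nu1 : 0 <= (7 / 8 : R) <= 1 by apply/andP; split; lra.
have e0 : 0 < 1 / 2 :> R by lra.
have := herm_sqr_bound n u nu1 e0; rewrite -/K => H.
have -> : (L ^+ n) ^+ 2 * ((3 / 8) ^+ n * n`!%:R) = n`!%:R * K ^+ n.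
  have -> : (L ^+ n) ^+ 2 = (K / (3 / 8)) ^+ n by rewrite -L2 -!exprM mulnC.
  have h38 : 3 / 8 != 0 :> R by lra.
  by rewrite mulrA -exprMn (divfK h38) [LHS]mulrC.
have -> : n`!%:R * K ^+ n = n`!%:R * K ^+ n * expR (1 / 2 * u ^+ 2) * gfun (1 / 4) 0 u ^+ 2.
  rewrite -[LHS]mulr1 -[RHS]mulrA; congr (_ * _).
  by rewrite /gfun [expR _ ^+ 2]expr2 -!expRD -expR0; congr expR; field.
by rewrite ler_wpM2r ?exprn_ge0 ?gfun_ge0.
Qed.

Lemma bump_obs_le (B : R) j x :
  (forall u, `|bump_mix j u| <= B * base_mix u) ->
  `|bump_obs j x| <= B * base_obs x.
Proof.
move=> HB; rewrite -conv_bump_mix -conv_base_mix.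
apply: le_trans (le_normr_Rintegral _ (integrable_conv_bump_mix j x)) _ => //.
rewrite -RintegralZl//; last exact: integrable_conv_base_mix.
apply: le_Rintegral => //.
- exact: (integrable_norm (integrable_conv_bump_mix j x)).
- exact: (integrableZl measurableT B (integrable_conv_base_mix x)).
move=> u _; rewrite normrM ger0_norm ?normal_pdf_ge0// mulrCA.
by rewrite ler_wpM2l// normal_pdf_ge0.
Qed.

Lemma base_mix_expE u : expR (1 / 8 * u ^+ 2) * base_mix u =
  (gmass (1 / 4))^-1 * gfun (1 / 8) 0 u.
Proof.
rewrite /base_mix mulrA [LHS]mulrC; congr (_ * _).
by rewrite /gfun -expRD; congr expR; field.
Qed.

End bumps.

(** * The squared Hellinger distance *)

Lemma measurable_sqrtr (R : realType) : measurable_fun setT (@Num.sqrt R).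
Proof. by apply: continuous_measurable_fun; exact: sqrt_continuous. Qed.

Lemma lee_prode_const (R : realType) k (a : R) (A : \bar R) :
  0 <= a -> (a%:E <= A)%E -> ((a ^+ k)%:E <= \prod_(i < k) A)%E.
Proof.
move=> a0 aA; elim: k => [|k IH]; first by rewrite big_ord0 expr0.
by rewrite big_ord_recl exprS EFinM lee_pmul// lee_fin exprn_ge0.
Qed.

Section hellinger.
Context {R : realType} {d : nat}.
Implicit Types f g h : Rvec R d -> R.
Local Notation leb := (lebesgue_vec R d).

Lemma measurable_hellinger_integrand f g :
  measurable_fun setT f -> measurable_fun setT g ->
  measurable_fun setT (fun x => ((Num.sqrt (f x) - Num.sqrt (g x)) ^+ 2)%:E).
Proof.
move=> mf mg; apply/measurable_EFinP; apply: measurable_funX.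
by apply: measurable_funB; exact: (measurableT_comp (@measurable_sqrtr R)).
Qed.

Lemma hellinger2_ge0 f g : (0 <= hellinger2 f g)%E.
Proof. by apply: integral_ge0 => x _; rewrite lee_fin sqr_ge0. Qed.

(** (sqrt f - sqrt g) ^ 2 <= 2 (sqrt h - sqrt f) ^ 2 + 2 (sqrt h - sqrt g) ^ 2. *)
Lemma hellinger2_triangle f g h :
  measurable_fun setT f -> measurable_fun setT g -> measurable_fun setT h ->
  (hellinger2 f g <= 2%:E * hellinger2 h f + 2%:E * hellinger2 h g)%E.
Proof.
move=> mf mg mh; rewrite /hellinger2.
rewrite -!ge0_integralZl//; try by [exact: measurable_hellinger_integrand | move=> x _; rewrite lee_fin sqr_ge0].
rewrite -ge0_integralD//; last 4 first.
- by move=> x _; rewrite -EFinM lee_fin mulr_ge0// sqr_ge0.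
- by apply: emeasurable_funM => //; exact: measurable_hellinger_integrand.
- by move=> x _; rewrite -EFinM lee_fin mulr_ge0// sqr_ge0.
- by apply: emeasurable_funM => //; exact: measurable_hellinger_integrand.
apply: ge0_le_integral => //.
- by move=> x _; rewrite lee_fin sqr_ge0.
- exact: measurable_hellinger_integrand.
- by apply: emeasurable_funD; apply: emeasurable_funM => //; exact: measurable_hellinger_integrand.
move=> x _; rewrite -!EFinM -EFinD lee_fin.
move: (Num.sqrt (f x)) (Num.sqrt (g x)) (Num.sqrt (h x)) => a b c.
rewrite -subr_ge0 (_ : _ - _ = ((a - c) + (b - c)) ^+ 2); first exact: sqr_ge0.
ring.
Qed.

End hellinger.

(** * Assouad's lemma *)

Section assouad.
Context {R : realType} {d n : nat} {I : finType}.
Implicit Types (al be : {ffun I -> bool}).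
Local Notation leb := (lebesgue_vec R d).
Local Notation lebn := (tuple_measure leb n).

Definition flip (J : I) al : {ffun I -> bool} :=
  [ffun K => if K == J then ~~ al K else al K].

Lemma flipK J : involutive (flip J).
Proof.
by move=> al; apply/ffunP => K; rewrite !ffunE; case: eqP => // _; rewrite negbK.
Qed.

(** Flipping the J-th coordinate is an involution, and of [al] and [flip J al] exactly
    one disagrees with [be] at J; so each pair contributes at least the smaller of
    the two weights. *)
Lemma mismatch_sum_ge (L : {ffun I -> bool} -> R) (be : {ffun I -> bool}) :
  (forall al, 0 <= L al) ->
  \sum_J 2^-1 * \sum_al Num.min (L al) (L (flip J al)) <=
  \sum_al L al * \sum_J (be J != al J)%:R.
Proof.
move=> L0.
under [leRHS]eq_bigr do rewrite mulr_sumr.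
rewrite exchange_big/=; apply: ler_sum => J _.
rewrite ler_pdivrMl// mulr2n mulrDl !mul1r.
rewrite [X in _ <= _ + X](reindex_inj (inv_inj (flipK J)))/= -big_split/=.
apply: ler_sum => al _; rewrite ffunE eqxx.
case: (be J) (al J) => -[]; rewrite /= ?mulr1 ?mulr0 ?addr0 ?add0r ge_min lexx ?orbT//.
Qed.

Definition likelihood (f : density R d) (X : n.-tuple (Rvec R d)) : R :=
  \prod_(i < n) f (tnth X i).

Lemma likelihood_ge0 f X : 0 <= likelihood f X.
Proof. by apply: prodr_ge0 => i _; exact: density_ge0. Qed.

Lemma measurable_likelihood f : measurable_fun setT (likelihood f).
Proof.
apply: (measurable_prod_tnth (F := fun=> f)) => _; exact: measurable_density.
Qed.

Lemma integral_likelihood f : (\int[lebn]_X (likelihood f X)%:E = 1)%E.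
Proof.
rewrite (@ge0_integral_tuple_measure_prod _ _ _ leb n (fun=> f)).
- by rewrite big1// => i _; exact: integral_density.
- by move=> _; exact: measurable_density.
- by move=> _ x; exact: density_ge0.
Qed.

Lemma bernoulli_ineq (x : R) k : 0 <= x <= 1 -> 1 - k%:R * x <= (1 - x) ^+ k.
Proof.
move=> /andP[x0 x1]; elim: k => [|k IH]; first by rewrite mul0r subr0 expr0.
rewrite exprS; apply: (@le_trans _ _ ((1 - x) * (1 - k%:R * x))); last first.
  by rewrite ler_wpM2l// subr_ge0.
rewrite -natr1; have := mulr_ge0 (ler0n R k) (sqr_ge0 x); rewrite expr2; nra.
Qed.

(** sqrt (a * b) = sqrt min * sqrt max <= min + max / 4. *)
Lemma geometric_mean_le (a b s : R) : 0 <= a -> 0 <= b -> 0 <= s -> s ^+ 2 = a * b ->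
  s <= Num.min a b + (a + b) / 4.
Proof.
wlog ab : a b / a <= b.
  move=> H a0 b0 s0 sE; case/orP: (le_total a b) => [ab|ba]; first exact: H.
  by rewrite minC [a + b]addrC; apply: H => //; rewrite mulrC.
move=> a0 b0 s0 sE; rewrite (min_idPl ab).
apply: (@le_trans _ _ (a + b / 4)); last lra.
rewrite -(ler_pXn2r (n := 2)) ?nnegrE//; last by rewrite addr_ge0// divr_ge0.
rewrite sE -subr_ge0 (_ : _ - _ = (a - b / 4) ^+ 2); [exact: sqr_ge0|by field].
Qed.

(** The affinity of the two sample laws is the n-th power of that of f and g, at
    least 3 / 4 by Bernoulli's inequality; [geometric_mean_le] compares it with the
    minimum of the likelihoods. *)
Lemma integral_min_likelihood (f g : density R d) : (0 < n)%N ->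
  ((1 - (4 * n%:R)^-1)%:E <= \int[leb]_x (Num.sqrt (f x * g x))%:E)%E ->
  ((4^-1)%:E <=
   \int[lebn]_X (Num.min (likelihood f X) (likelihood g X))%:E)%E.
Proof.
move=> n0 fg.
have nR : 1 <= n%:R :> R by rewrite ler1n.
pose s (x : Rvec R d) := Num.sqrt (f x * g x).
have ms : measurable_fun setT s.
  apply: (measurableT_comp (@measurable_sqrtr R)).
  by apply: measurable_funM; exact: measurable_density.
pose S (X : n.-tuple (Rvec R d)) := \prod_(i < n) s (tnth X i).
have S0 X : 0 <= S X by apply: prodr_ge0 => i _; exact: sqrtr_ge0.
have mS : measurable_fun setT S by exact: (measurable_prod_tnth (F := fun=> s)).
have S2 X : S X ^+ 2 = likelihood f X * likelihood g X.
  rewrite -prodrXl -big_split/=; apply: eq_bigr => i _.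
  by rewrite sqr_sqrtr// mulr_ge0 ?density_ge0.
have mmin : measurable_fun setT (fun X => Num.min (likelihood f X) (likelihood g X)).
  by apply: measurable_minr; exact: measurable_likelihood.
have min0 X : 0 <= Num.min (likelihood f X) (likelihood g X).
  by rewrite le_min !likelihood_ge0.
have intS : ((3 / 4)%:E <= \int[lebn]_X (S X)%:E)%E.
  rewrite (@ge0_integral_tuple_measure_prod _ _ _ leb n (fun=> s))//; last first.
    by move=> _ x; exact: sqrtr_ge0.
  have q1 : 0 <= ((4 * n%:R)^-1 : R) <= 1.
    by rewrite invr_ge0 mulr_ge0//= invf_le1; lra.
  apply: le_trans (lee_prode_const n _ fg); last by case/andP: q1; lra.
  rewrite lee_fin; apply: le_trans (bernoulli_ineq _ q1).
  by rewrite invfM mulrCA divff ?mulr1; [lra|rewrite gt_eqF// ltr0n].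
have intSle : (\int[lebn]_X (S X)%:E <= \int[lebn]_X (Num.min (likelihood f X) (likelihood g X))%:E + (2^-1)%:E)%E.
  apply: (@le_trans _ _ (\int[lebn]_X ((Num.min (likelihood f X) (likelihood g X))%:E + ((4^-1)%:E * (likelihood f X)%:E + (4^-1)%:E * (likelihood g X)%:E)))%E).
    apply: ge0_le_integral => //.
    - by move=> X _; rewrite lee_fin.
    - by apply/measurable_EFinP.
    - apply/measurable_EFinP; apply: measurable_funD => //.
      by apply: measurable_funD; apply: measurable_funM => //; exact: measurable_likelihood.
    - move=> X _; rewrite -!EFinM -!EFinD lee_fin.
      apply: (le_trans (geometric_mean_le _ _ (S0 X) (S2 X))); rewrite ?likelihood_ge0//.
      lra.
  rewrite ge0_integralD//; last 4 first.
  - by move=> X _; rewrite lee_fin.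
  - by apply/measurable_EFinP.
  - move=> X _; rewrite -!EFinM -!EFinD lee_fin.
    by rewrite !addr_ge0 ?mulr_ge0 ?likelihood_ge0.
  - apply/measurable_EFinP.
    by apply: measurable_funD; apply: measurable_funM => //; exact: measurable_likelihood.
  rewrite leeD2l// ge0_integralD//; last 4 first.
  - by move=> X _; rewrite -!EFinM lee_fin mulr_ge0 ?likelihood_ge0.
  - by apply/measurable_EFinP; apply: measurable_funM => //; exact: measurable_likelihood.
  - by move=> X _; rewrite -!EFinM lee_fin mulr_ge0 ?likelihood_ge0.
  - by apply/measurable_EFinP; apply: measurable_funM => //; exact: measurable_likelihood.
  rewrite !ge0_integralZl//; try by [apply/measurable_EFinP; exact: measurable_likelihood| move=> X _; rewrite lee_fin likelihood_ge0].
  rewrite !integral_likelihood !mule1 -EFinD lee_fin; lra.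
have := le_trans intS intSle.
rewrite -leeBlDr// -EFinB; apply: le_trans; rewrite lee_fin; lra.
Qed.

Lemma measurable_hellinger2_estimator fhat (f : density R d) : estimators R d n fhat ->
  measurable_fun setT (fun X => hellinger2 (fhat X) f).
Proof.
move=> [mfhat _].
apply: (measurable_fun_fubini_tonelli_F (m2 := leb)
    (fun z : n.-tuple (Rvec R d) * Rvec R d =>
     ((Num.sqrt (fhat z.1 z.2) - Num.sqrt (f z.2)) ^+ 2)%:E)).
  apply/measurable_EFinP; apply: measurable_funX; apply: measurable_funB.
    exact: (measurableT_comp (@measurable_sqrtr R) mfhat).
  apply: (measurableT_comp (@measurable_sqrtr R)).
  exact: (measurableT_comp (measurable_density f) measurable_snd).
by move=> z; rewrite lee_fin sqr_ge0.
Qed.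

Lemma hellinger_riskE fhat (f : density R d) : estimators R d n fhat ->
  (hellinger_risk fhat f = \int[lebn]_X ((likelihood f X)%:E * hellinger2 (fhat X) f))%E.
Proof.
move=> efhat; rewrite /hellinger_risk ge0_integral_iid_law//.
  exact: measurable_hellinger2_estimator.
by move=> X; exact: hellinger2_ge0.
Qed.

(** An arbitrary estimate can be replaced by the nearest vertex at the cost of a
    factor 4, so its loss is at least a multiple of the number of coordinates on
    which that vertex is wrong.  On average over the vertices each coordinate is
    wrong with a probability bounded below, because neighbours cannot be
    distinguished. *)
Theorem assouad (f : {ffun I -> bool} -> density R d) (rho : R) : (0 < n)%N ->
  0 <= rho ->
  (forall al be, ((rho * \sum_J (al J != be J)%:R)%:E <= hellinger2 (f al) (f be))%E) ->
  (forall J al, ((1 - (4 * n%:R)^-1)%:E <=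
    \int[leb]_x (Num.sqrt (f al x * f (flip J al) x))%:E)%E) ->
  forall fhat, estimators R d n fhat -> forall S : R,
  (forall al, (hellinger_risk fhat (f al) <= S%:E)%E) ->
  rho * #|I|%:R / 32 <= S.
Proof.
move=> n0 rho0 sep aff fhat efhat S riskS.
have mfa al := @measurable_density _ _ (f al).
have mfhat X : measurable_fun setT (fhat X).
  case: efhat => [mf _].
  apply: (measurableT_comp (f := fun z : n.-tuple (Rvec R d) * Rvec R d => fhat z.1 z.2)
    (g := fun x => (X, x)) mf).
  exact: measurable_fun_pair.
pose mn al J X := Num.min (likelihood (f al) X) (likelihood (f (flip J al)) X).
have mn0 al J X : 0 <= mn al J X by rewrite le_min !likelihood_ge0.
have mmn al J : measurable_fun setT (mn al J).
  by apply: measurable_minr; exact: measurable_likelihood.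
(* The nearest vertex [be] is chosen separately for each sample X; it no longer
   occurs in the resulting bound, which is then integrated over X. *)
have pointwise X : ((rho / 8 * \sum_J \sum_al mn al J X)%:E <=
    \sum_al (likelihood (f al) X)%:E * hellinger2 (fhat X) (f al))%E.
  pose be : {ffun I -> bool} := [arg min_(al < [ffun=> true]) hellinger2 (fhat X) (f al)]%O.
  have beP al : (hellinger2 (fhat X) (f be) <= hellinger2 (fhat X) (f al))%E.
    by rewrite /be; case: arg_minP => //= i _; apply.
  have far al : ((rho / 4 * \sum_J (be J != al J)%:R)%:E <= hellinger2 (fhat X) (f al))%E.
    have := le_trans (sep be al) (hellinger2_triangle (mfa be) (mfa al) (mfhat X)).
    have := beP al; have := hellinger2_ge0 (fhat X) (f be).
    case: (hellinger2 _ _) => [r||]; case: (hellinger2 _ _) => [r'||] //=; rewrite ?leey// !lee_fin.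
    by move=> *; lra.
  apply: (@le_trans _ _ (\sum_al (likelihood (f al) X * (rho / 4 * \sum_J (be J != al J)%:R))%:E)%E); last first.
    by apply: lee_sum => al _; rewrite EFinM lee_wpmul2l// lee_fin likelihood_ge0.
  rewrite sumEFin lee_fin.
  under [leRHS]eq_bigr do rewrite mulrCA.
  rewrite -mulr_sumr.
  have -> : rho / 8 * \sum_J \sum_al mn al J X = rho / 4 * \sum_J 2^-1 * \sum_al mn al J X.
    by rewrite -mulr_sumr; field.
  rewrite ler_wpM2l ?divr_ge0//; apply: (@mismatch_sum_ge (fun al => likelihood (f al) X) be).
  by move=> al; exact: likelihood_ge0.
have N0 : 0 < #|{ffun I -> bool}|%:R :> R.
  by rewrite ltr0n; apply/card_gt0P; exists [ffun=> true].
suff : ((rho / 8 * (#|I|%:R * (#|{ffun I -> bool}|%:R * 4^-1)))%:E <=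
        (#|{ffun I -> bool}|%:R * S)%:E)%E.
  rewrite lee_fin => H; rewrite -(ler_pM2l N0); apply: le_trans H.
  by rewrite le_eqVlt; apply/orP; left; apply/eqP; field.
apply: (@le_trans _ _ (\sum_(al : {ffun I -> bool}) hellinger_risk fhat (f al))%E); last first.
  apply: (@le_trans _ _ (\sum_(al : {ffun I -> bool}) S%:E)%E); first exact: lee_sum.
  by rewrite sumEFin sumr_const mulr_natl.
under eq_bigr do rewrite hellinger_riskE//.
have mLh al : measurable_fun setT (fun X => (likelihood (f al) X)%:E * hellinger2 (fhat X) (f al))%E.
  apply: emeasurable_funM; last exact: measurable_hellinger2_estimator.
  by apply/measurable_EFinP; exact: measurable_likelihood.
rewrite -ge0_integral_sum//; last first.
  by move=> al X _; rewrite mule_ge0 ?hellinger2_ge0// lee_fin likelihood_ge0.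
have msum : measurable_fun setT (fun X => \sum_J \sum_al mn al J X).
  by apply: measurable_sum => J; apply: measurable_sum => al; exact: mmn.
have sum0 X : 0 <= \sum_J \sum_al mn al J X.
  by apply: sumr_ge0 => J _; apply: sumr_ge0.
apply: (@le_trans _ _ (\int[lebn]_X (rho / 8 * \sum_J \sum_al mn al J X)%:E)%E); last first.
  apply: ge0_le_integral => //.
  - by move=> X _; rewrite lee_fin mulr_ge0 ?divr_ge0.
  - by apply/measurable_EFinP; apply: measurable_funM.
  - by apply: emeasurable_sum => al; exact: mLh.
under eq_integral do rewrite EFinM.
rewrite ge0_integralZl//; last 3 first.
- by apply/measurable_EFinP.
- by move=> X _; rewrite lee_fin.
- by rewrite lee_fin divr_ge0.
rewrite EFinM lee_wpmul2l ?lee_fin ?divr_ge0//.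
under eq_integral do rewrite -sumEFin.
rewrite ge0_integral_sum//; last 2 first.
- by move=> J; apply/measurable_EFinP; apply: measurable_sum => al; exact: mmn.
- by move=> J X _; rewrite lee_fin sumr_ge0.
apply: (@le_trans _ _ (\sum_(J : I) (#|{ffun I -> bool}|%:R * 4^-1)%:E)%E).
  by rewrite sumEFin sumr_const mulr_natl.
apply: lee_sum => J _.
under eq_integral do rewrite -sumEFin.
rewrite ge0_integral_sum//; last 2 first.
- by move=> al; apply/measurable_EFinP; exact: mmn.
- by move=> al X _; rewrite lee_fin.
apply: (@le_trans _ _ (\sum_(al : {ffun I -> bool}) (4^-1)%:E)%E).
  by rewrite sumEFin sumr_const mulr_natl.
apply: lee_sum => al _; exact: integral_min_likelihood.
Qed.

End assouad.

(** * Integrals of finite linear combinations *)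

Section lincomb.
Context d (T : measurableType d) (R : realType) (mu : {measure set T -> \bar R}).
Context {I : Type}.

Lemma integral_lincomb (s : seq I) (c : I -> R) (F : I -> T -> R) :
  (forall i, mu.-integrable setT (EFin \o F i)) ->
  mu.-integrable setT (EFin \o (fun x => \sum_(i <- s) c i * F i x)) /\
  \int[mu]_x (\sum_(i <- s) c i * F i x) = \sum_(i <- s) c i * \int[mu]_x F i x.
Proof.
move=> iF; elim: s => [|i s [IH1 IH2]].
  under [EFin \o _]eq_fun do rewrite big_nil.
  under eq_Rintegral do rewrite big_nil.
  by rewrite big_nil Rintegral_cst// mul0r; split=> //; exact: integrable0.
under [EFin \o _]eq_fun do rewrite big_cons.
under eq_Rintegral do rewrite big_cons.
have i1 := integrable_EFinZl (c i) (iF i).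
rewrite big_cons RintegralD// RintegralZl// IH2; split => //.
exact: (integrableD measurableT i1 IH1).
Qed.

Lemma Rintegral_EFin (f : T -> R) : mu.-integrable setT (EFin \o f) ->
  (\int[mu]_x (f x)%:E = (\int[mu]_x f x)%:E)%E.
Proof. by move=> if_; rewrite /Rintegral fineK//; exact: integrable_fin_num. Qed.

Lemma integrable_EFinD (f g : T -> R) : mu.-integrable setT (EFin \o f) ->
  mu.-integrable setT (EFin \o g) ->
  mu.-integrable setT (EFin \o (fun x => f x + g x)).
Proof. exact: integrableD. Qed.

End lincomb.

(** * Perturbing a positive function *)

Section perturbation.
Context {R : realType} {I : finType} (eps : R).
Implicit Types (al be : {ffun I -> bool}).

(** [F0] and [F] are the values of the base function and of the directions at a
    point, so that the same inequalities serve for mixing densities and for mixture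
    densities. *)
Definition perturb al (F0 : R) (F : I -> R) : R :=
  F0 + eps * \sum_J (al J)%:R * F J.

Lemma perturb_bounds al F0 F D : 0 <= eps -> 0 <= F0 ->
  (forall J, `|F J| <= D * F0) -> eps * (#|I|%:R * D) <= 2^-1 ->
  2^-1 * F0 <= perturb al F0 F <= 3 / 2 * F0.
Proof.
move=> e0 F00 FD small.
have : `|eps * \sum_J (al J)%:R * F J| <= 2^-1 * F0.
  rewrite normrM (ger0_norm e0).
  apply: (@le_trans _ _ (eps * (#|I|%:R * D) * F0)); last by rewrite ler_wpM2r.
  rewrite -!mulrA ler_wpM2l// (le_trans (ler_norm_sum _ _ _))//.
  rewrite mulr_natl -sumr_const; apply: ler_sum => J _.
  rewrite normrM; apply: le_trans (FD J); rewrite ler_piMl//.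
  by case: (al J); rewrite ?normr1 ?normr0.
by rewrite ler_norml /perturb => /andP[]; lra.
Qed.

Lemma perturbB al be F0 F : perturb al F0 F - perturb be F0 F =
  eps * \sum_J ((al J)%:R - (be J)%:R) * F J.
Proof.
rewrite /perturb opprD addrACA subrr add0r -mulrBr; congr (_ * _).
by rewrite -sumrB; apply: eq_bigr => J _; rewrite mulrBl.
Qed.

Lemma perturb_flip J al F0 F :
  (perturb al F0 F - perturb (flip J al) F0 F) ^+ 2 = eps ^+ 2 * F J ^+ 2.
Proof.
rewrite perturbB (bigD1 J)//= big1 ?addr0; last first.
  by move=> K /negPf KJ; rewrite ffunE KJ subrr mul0r.
by rewrite ffunE eqxx; case: (al J) => /=; ring.
Qed.

(** From (a - b) ^ 2 = (sqrt a - sqrt b) ^ 2 * (sqrt a + sqrt b) ^ 2 and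
    (sqrt a + sqrt b) ^ 2 <= 2 * (a + b). *)
Lemma sqrtB_ge (a b F0 : R) : 0 < F0 -> 0 <= a <= 3 / 2 * F0 ->
  0 <= b <= 3 / 2 * F0 ->
  (a - b) ^+ 2 / F0 / 6 <= (Num.sqrt a - Num.sqrt b) ^+ 2.
Proof.
move=> F00 /andP[a0 aF] /andP[b0 bF].
have := sqr_sqrtr a0; have := sqr_sqrtr b0.
move: (Num.sqrt a) (Num.sqrt b) (sqrtr_ge0 a) (sqrtr_ge0 b) => s t s0 t0 tE sE.
rewrite !ler_pdivrMr// -sE -tE subr_sqr exprMn -mulrA ler_wpM2l ?sqr_ge0//.
have := sqr_ge0 (s - t); rewrite sqrrB sqrrD sE tE; lra.
Qed.

(** Here (sqrt a - sqrt b) ^ 2 is bounded above through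
    (sqrt a + sqrt b) ^ 2 >= a + b >= F0. *)
Lemma sqrtM_ge (a b F0 : R) : 0 < F0 -> 2^-1 * F0 <= a -> 2^-1 * F0 <= b ->
  (a + b) / 2 <= Num.sqrt (a * b) + (a - b) ^+ 2 / F0 / 2.
Proof.
move=> F00 aF bF.
have a0 : 0 <= a by lra. have b0 : 0 <= b by lra.
rewrite sqrtrM//.
have := sqr_sqrtr a0; have := sqr_sqrtr b0.
move: (Num.sqrt a) (Num.sqrt b) (sqrtr_ge0 a) (sqrtr_ge0 b) => s t s0 t0 tE sE.
have : (s - t) ^+ 2 <= (a - b) ^+ 2 / F0.
  rewrite ler_pdivlMr// -sE -tE subr_sqr exprMn ler_wpM2l ?sqr_ge0//.
  by have := mulr_ge0 s0 t0; rewrite sqrrD sE tE; lra.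
rewrite sqrrB sE tE; lra.
Qed.

End perturbation.

(** * The hypercube of mixture densities *)

Section family.
Context {R : realType} {d m : nat}.
Variables (eps B : R).
Local Notation I := {ffun 'I_d -> 'I_m}.
Local Notation mu := (@lebesgue_measure R).
Local Notation leb := (lebesgue_vec R d).
Hypotheses (d0 : (0 < d)%N) (eps0 : 0 <= eps) (B1 : 1 <= B).
Hypothesis bumpB : forall j u, `|bump_mix j u| <= B ^+ j.+1 * @base_mix R u.
Hypothesis small : eps * (#|{: I}|%:R * (B ^+ m) ^+ d) <= 2^-1.
Implicit Types (u x : Rvec R d) (J K : I) (al be : {ffun I -> bool}).

Definition base_mix_vec u : R := \prod_(i < d) base_mix (tnth u i : R).
Definition base_obs_vec x : R := \prod_(i < d) base_obs (tnth x i : R).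
Definition bump_mix_vec J u : R := \prod_(i < d) bump_mix (J i) (tnth u i : R).
Definition bump_obs_vec J x : R := \prod_(i < d) bump_obs (J i) (tnth x i : R).

Lemma base_mix_vec_gt0 u : 0 < base_mix_vec u.
Proof. by apply: prodr_gt0 => i _; exact: base_mix_gt0. Qed.

Lemma base_obs_vec_gt0 x : 0 < base_obs_vec x.
Proof. by apply: prodr_gt0 => i _; exact: base_obs_gt0. Qed.

Lemma norm_prod_le (f g : 'I_d -> R) :
  (forall i, `|f i| <= B ^+ m * g i) ->
  `|\prod_(i < d) f i| <= (B ^+ m) ^+ d * \prod_(i < d) g i.
Proof.
move=> fg; rewrite normr_prod -[in (B ^+ m) ^+ d](card_ord d) -prodr_const -big_split/=.
by apply: ler_prod => i _; rewrite normr_ge0 fg.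
Qed.

Lemma bump_mix_le_top (j : 'I_m) (u : R) : `|bump_mix j u| <= B ^+ m * base_mix u.
Proof.
apply: le_trans (bumpB j u) _; rewrite ler_wpM2r ?(ltW (base_mix_gt0 _))//.
by rewrite ler_weXn2l.
Qed.

Lemma bump_mix_vec_le J u : `|bump_mix_vec J u| <= (B ^+ m) ^+ d * base_mix_vec u.
Proof. by apply: norm_prod_le => i; exact: bump_mix_le_top. Qed.

Lemma bump_obs_vec_le J x : `|bump_obs_vec J x| <= (B ^+ m) ^+ d * base_obs_vec x.
Proof.
by apply: norm_prod_le => i; apply: bump_obs_le => u; exact: bump_mix_le_top.
Qed.

Definition pmix al u := perturb eps al (base_mix_vec u) (bump_mix_vec ^~ u).
Definition pobs al x := perturb eps al (base_obs_vec x) (bump_obs_vec ^~ x).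

Lemma pmix_bounds al u : 2^-1 * base_mix_vec u <= pmix al u <= 3 / 2 * base_mix_vec u.
Proof.
apply: perturb_bounds small => // [|J]; first exact/ltW/base_mix_vec_gt0.
exact: bump_mix_vec_le.
Qed.

Lemma pobs_bounds al x : 2^-1 * base_obs_vec x <= pobs al x <= 3 / 2 * base_obs_vec x.
Proof.
apply: perturb_bounds small => // [|J]; first exact/ltW/base_obs_vec_gt0.
exact: bump_obs_vec_le.
Qed.

Lemma pmix_ge0 al u : 0 <= pmix al u.
Proof.
have /andP[+ _] := pmix_bounds al u; apply: le_trans.
by rewrite mulr_ge0// ltW// base_mix_vec_gt0.
Qed.

Lemma integrable_pmix al : leb.-integrable setT (EFin \o pmix al) /\
  \int[leb]_u pmix al u = 1.
Proof.
have ib : leb.-integrable setT (EFin \o base_mix_vec).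
  exact: (integrable_tuple_measure_prod (fun _ : 'I_d => integrable_base_mix)).
have iB J : leb.-integrable setT (EFin \o bump_mix_vec J).
  exact: (integrable_tuple_measure_prod (fun i => integrable_bump_mix (J i))).
have [iS SE] := integral_lincomb (index_enum I) (fun J => (al J)%:R) iB.
have iS' := integrable_EFinZl eps iS.
split; first exact: integrable_EFinD.
rewrite /pmix /perturb RintegralD// RintegralZl// SE.
rewrite (Rintegral_tuple_measure_prod (fun _ : 'I_d => integrable_base_mix)).
rewrite [X in X + _]big1 => [|i _]; last exact: Rintegral_base_mix.
rewrite big1 ?mulr0 ?addr0// => J _.
rewrite (Rintegral_tuple_measure_prod (fun i => integrable_bump_mix (J i))).
by rewrite (bigD1 (Ordinal d0))//= Rintegral_bump_mix mul0r mulr0.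
Qed.

Lemma measurable_pmix al : measurable_fun setT (pmix al).
Proof.
apply/measurable_EFinP; have [+ _] := integrable_pmix al; exact: measurable_int.
Qed.

Lemma integral_pmix al : (\int[leb]_u (pmix al u)%:E = 1)%E.
Proof. by have [ip E] := integrable_pmix al; rewrite Rintegral_EFin// E. Qed.

Definition pmix_density al : density R d :=
  Density (measurable_pmix al) (pmix_ge0 al) (integral_pmix al).

Definition pobs_density al : density R d := mixture (density_prob (pmix_density al)).

(** The Gaussian kernel factorizes, so convolution acts coordinatewise on tensor
    products. *)
Lemma pobs_densityE al x : pobs_density al x = pobs al x.
Proof.
rewrite /= /mixture_pdf /Rintegral ge0_integral_density_prob; last 2 first.
- by apply/measurable_EFinP; exact: measurable_gauss_kernel_r.
- by move=> u; rewrite lee_fin gauss_kernel_ge0.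
pose k0 i (v : R) := normal_pdf 0 1 ((tnth x i : R) - v) * base_mix v.
pose kb J i (v : R) := normal_pdf 0 1 ((tnth x i : R) - v) * bump_mix (J i) v.
have ik0 i : mu.-integrable setT (EFin \o k0 i) by exact: integrable_conv_base_mix.
have ikb J i : mu.-integrable setT (EFin \o kb J i) by exact: integrable_conv_bump_mix.
have ib := integrable_tuple_measure_prod ik0.
have iB J := integrable_tuple_measure_prod (ikb J).
have [iS SE] := integral_lincomb (index_enum I) (fun J => (al J)%:R) iB.
have iS' := integrable_EFinZl eps iS.
transitivity (\int[leb]_u (\prod_i k0 i (tnth u i) +
    eps * \sum_J (al J)%:R * \prod_i kb J i (tnth u i))).
  rewrite /Rintegral; congr fine; apply: eq_integral => u _.
  rewrite -EFinM; congr EFin; rewrite /pmix /perturb mulrC mulrDr; congr (_ + _).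
    by rewrite /gauss_kernel -big_split.
  rewrite mulrCA; congr (_ * _); rewrite mulr_sumr; apply: eq_bigr => J _.
  by rewrite mulrCA; congr (_ * _); rewrite /gauss_kernel -big_split.
rewrite RintegralD// RintegralZl// SE (Rintegral_tuple_measure_prod ik0).
rewrite /pobs /perturb; congr (_ + eps * _).
  by apply: eq_bigr => i _; exact: conv_base_mix.
apply: eq_bigr => J _; rewrite (Rintegral_tuple_measure_prod (ikb J)).
by congr (_ * _); apply: eq_bigr => i _; exact: conv_bump_mix.
Qed.

Let bump_obs_gram J K x : bump_obs_vec J x * bump_obs_vec K x / base_obs_vec x =
  \prod_i (bump_obs (J i) (tnth x i) * bump_obs (K i) (tnth x i) / base_obs (tnth x i)).
Proof. by rewrite /bump_obs_vec -big_split -prodf_div. Qed.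

Lemma integrable_bump_obs_vec_mul J K : leb.-integrable setT
  (EFin \o (fun x => bump_obs_vec J x * bump_obs_vec K x / base_obs_vec x)).
Proof.
under [EFin \o _]eq_fun do rewrite bump_obs_gram.
exact: (integrable_tuple_measure_prod (fun i => integrable_bump_obs_mul (J i) (K i))).
Qed.

Lemma Rintegral_bump_obs_vec_mul J K :
  \int[leb]_x (bump_obs_vec J x * bump_obs_vec K x / base_obs_vec x) = (J == K)%:R.
Proof.
under eq_Rintegral do rewrite bump_obs_gram.
rewrite (Rintegral_tuple_measure_prod (fun i => integrable_bump_obs_mul (J i) (K i))).
under eq_bigr do rewrite Rintegral_bump_obs_mul.
have [->|/eqP JK] := eqVneq J K; first by rewrite big1// => i _; rewrite eqxx.
have [i Ji] : exists i, J i != K i.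
  by apply/existsP; apply: contra_notT JK => /existsPn H; apply/ffunP => i; apply/eqP/negPn/H.
by rewrite (bigD1 i)//= (_ : (_ == _) = false) ?mul0r//; apply/negbTE.
Qed.

(** The quadratic form of the coefficient differences is diagonal by orthonormality,
    and [sqrtB_ge] bounds the Hellinger integrand below by its integrand. *)
Lemma pobs_separation al be :
  ((eps ^+ 2 / 6 * \sum_J (al J != be J)%:R)%:E <=
    hellinger2 (pobs_density al) (pobs_density be))%E.
Proof.
pose c (p : I * I) := (((al p.1)%:R - (be p.1)%:R) * ((al p.2)%:R - (be p.2)%:R) : R).
have iF (p : I * I) := integrable_bump_obs_vec_mul p.1 p.2.
have [iS SE] := integral_lincomb (index_enum (I * I)%type) c iF.
have iS' := integrable_EFinZl (eps ^+ 2 / 6) iS.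
pose Fx x := eps ^+ 2 / 6 * \sum_p c p * (bump_obs_vec p.1 x * bump_obs_vec p.2 x / base_obs_vec x).
have FE x : Fx x = (pobs al x - pobs be x) ^+ 2 / base_obs_vec x / 6.
  have sqE : (\sum_J ((al J)%:R - (be J)%:R) * bump_obs_vec J x) ^+ 2 / base_obs_vec x =
      \sum_p c p * (bump_obs_vec p.1 x * bump_obs_vec p.2 x / base_obs_vec x).
    rewrite expr2 mulr_suml; under eq_bigr do rewrite mulr_sumr.
    rewrite pair_bigA/= mulr_suml; apply: eq_bigr => -[J K] _ /=; rewrite /c/=; ring.
  by rewrite perturbB exprMn -[_ * _ / base_obs_vec x]mulrA sqE /Fx; ring.
have -> : (eps ^+ 2 / 6 * \sum_J (al J != be J)%:R)%:E = (\int[leb]_x (Fx x)%:E)%E.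
  rewrite Rintegral_EFin// /Fx RintegralZl// SE; congr (_ * _)%:E.
  under [RHS]eq_bigr do rewrite Rintegral_bump_obs_vec_mul.
  rewrite -(pair_bigA _ (fun J K => c (J, K) * (J == K)%:R))/=.
  apply: eq_bigr => J _; rewrite (bigD1 J)//= big1 ?addr0; last first.
    by move=> K KJ; rewrite eq_sym (negbTE KJ) mulr0.
  by rewrite eqxx /c/=; case: (al J); case: (be J) => /=; ring.
apply: ge0_le_integral => //.
- move=> x _; rewrite lee_fin FE; do 2 apply: divr_ge0 => //.
    exact: sqr_ge0.
  exact/ltW/base_obs_vec_gt0.
- exact: (measurable_int _ iS').
- by apply: measurable_hellinger_integrand; exact: measurable_density.
move=> x _; rewrite lee_fin !pobs_densityE FE.
have F0 := base_obs_vec_gt0 x.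
have /andP[a1 a2] := pobs_bounds al x; have /andP[b1 b2] := pobs_bounds be x.
by apply: sqrtB_ge => //; apply/andP; split => //; lra.
Qed.

(** Neighbours differ by a single unit vector of L^2(1 / base_obs) times [eps]. *)
Lemma pobs_affinity J al :
  ((1 - eps ^+ 2 / 2)%:E <= \int[leb]_x
    (Num.sqrt (pobs_density al x * pobs_density (flip J al) x))%:E)%E.
Proof.
set be := flip J al.
pose G x := bump_obs_vec J x * bump_obs_vec J x / base_obs_vec x.
have iG : leb.-integrable setT (EFin \o G) := integrable_bump_obs_vec_mul J J.
have G0 x : 0 <= G x.
  by rewrite divr_ge0 ?(ltW (base_obs_vec_gt0 _))// -expr2 sqr_ge0.
have mG := measurable_int _ iG.
have IG : (\int[leb]_x (G x)%:E = 1)%E.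
  by rewrite Rintegral_EFin// Rintegral_bump_obs_vec_mul eqxx.
have md al' := @measurable_density _ _ (pobs_density al').
have d0' al' x := @density_ge0 _ _ (pobs_density al') x.
have ms : measurable_fun setT (fun x => (Num.sqrt (pobs_density al x * pobs_density be x))%:E).
  apply/measurable_EFinP; apply: (measurableT_comp (@measurable_sqrtr R)).
  exact: measurable_funM.
have h20 : (0 <= (2^-1 : R)%:E)%E by rewrite lee_fin.
have e20 : (0 <= (eps ^+ 2 / 2)%:E)%E by rewrite lee_fin divr_ge0 ?sqr_ge0.
have mdE al' : measurable_fun setT (fun x => (pobs_density al' x)%:E).
  by apply/measurable_EFinP; exact: md.
suff : (1 <= \int[leb]_x (Num.sqrt (pobs_density al x * pobs_density be x))%:E
    + (eps ^+ 2 / 2)%:E)%E by rewrite EFinB leeBlDr.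
have -> : ((eps ^+ 2 / 2)%:E = \int[leb]_x ((eps ^+ 2 / 2)%:E * (G x)%:E))%E.
  by rewrite ge0_integralZl ?IG ?mule1// => x _; rewrite lee_fin.
rewrite -ge0_integralD//; last 2 first.
- by move=> x _; rewrite mule_ge0// lee_fin.
- exact: emeasurable_funM.
apply: (@le_trans _ _ (\int[leb]_x ((2^-1)%:E * (pobs_density al x)%:E +
    (2^-1)%:E * (pobs_density be x)%:E))%E).
  rewrite ge0_integralD//; last 4 first.
  - by move=> x _; rewrite mule_ge0// lee_fin.
  - exact: emeasurable_funM.
  - by move=> x _; rewrite mule_ge0// lee_fin.
  - exact: emeasurable_funM.
  rewrite !ge0_integralZl//; try by move=> x _; rewrite lee_fin.
  by rewrite !integral_density !mule1 -EFinD lee_fin; lra.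
apply: ge0_le_integral => //.
- by move=> x _; rewrite -!EFinM -EFinD lee_fin addr_ge0// mulr_ge0.
- by apply: emeasurable_funD; exact: emeasurable_funM.
- by apply: emeasurable_funD => //; exact: emeasurable_funM.
move=> x _; rewrite -!EFinM -!EFinD lee_fin !pobs_densityE.
have F0 := base_obs_vec_gt0 x.
have /andP[a1 _] := pobs_bounds al x; have /andP[b1 _] := pobs_bounds be x.
have := sqrtM_ge F0 a1 b1; rewrite perturb_flip /G.
move=> H; apply: le_trans (le_trans H _); first lra.
rewrite lerD2l le_eqVlt; apply/orP; left; apply/eqP; field.
by rewrite gt_eqF.
Qed.

Lemma measurable_enorm : measurable_fun setT (@enorm R d).
Proof.
apply: (measurableT_comp (@measurable_sqrtr R)); apply: measurable_sum => i.
by apply: measurable_funX; exact: measurable_tnth.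
Qed.

(** Chernoff's bound with exponent |u| ^ 2 / 8, integrable against the base measure,
    whose density is a multiple of exp (- |u| ^ 2 / 4). *)
Lemma pmix_tail al t : 0 < t ->
  (density_prob (pmix_density al) [set u | (t < enorm u)%R] <=
   (3 / 2 * (gmass (1 / 8) / gmass (1 / 4)) ^+ d * expR (- t ^+ 2 / 8))%:E)%E.
Proof.
move=> t0; rewrite /density_prob integral_mkcond.
set A := [set u | _].
have mA : measurable A.
  rewrite -[A]setTI (_ : A = @enorm R d @^-1` `]t, +oo[%classic).
    by apply: measurable_enorm => //; exact: measurable_itv.
  by apply/seteqP; split => u /=; rewrite in_itv/= andbT.
pose E (v : R) := expR (1 / 8 * v ^+ 2) * base_mix v.
have EE v : E v = (gmass (1 / 4))^-1 * gfun (1 / 8) 0 v by exact: base_mix_expE.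
have h8 : 0 < 1 / 8 :> R by lra.
have h4 : 0 < 1 / 4 :> R by lra.
have iE : mu.-integrable setT (EFin \o E).
  rewrite (_ : E = (fun v => (gmass (1 / 4))^-1 * gfun (1 / 8) 0 v)); last exact/funext.
  exact/integrable_EFinZl/integrable_gfun.
have iEd := integrable_tuple_measure_prod (fun _ : 'I_d => iE).
have intE : \int[leb]_u (\prod_(i < d) E (tnth u i)) = (gmass (1 / 8) / gmass (1 / 4)) ^+ d.
  rewrite (Rintegral_tuple_measure_prod (fun _ : 'I_d => iE)) prodr_const card_ord.
  congr (_ ^+ _); under eq_Rintegral do rewrite EE.
  rewrite RintegralZl//; last exact: integrable_gfun.
  by rewrite Rintegral_gfun// [LHS]mulrC.
pose H u := (3 / 2 * expR (- t ^+ 2 / 8)) * \prod_(i < d) E (tnth u i).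
have iH : leb.-integrable setT (EFin \o H) by exact: integrable_EFinZl.
have H0 u : 0 <= H u.
  rewrite mulr_ge0 ?mulr_ge0 ?expR_ge0// prodr_ge0// => i _.
  by rewrite mulr_ge0 ?expR_ge0// ltW// base_mix_gt0.
rewrite [leRHS](_ : _ = \int[leb]_u (H u)%:E)%E; last first.
  by rewrite Rintegral_EFin// RintegralZl// intE; congr EFin; ring.
apply: ge0_le_integral => //.
- by move=> u _; rewrite patchE; case: ifP => // _; rewrite lee_fin pmix_ge0.
- apply/(measurable_restrictT _ mA); apply: measurable_funTS.
  exact: measurable_EFin_density.
- exact: (measurable_int _ iH).
move=> u _; rewrite patchE; case: ifPn => [|_]; last by rewrite lee_fin.
rewrite inE /A/= => tu; rewrite lee_fin.
have /andP[_ +] := pmix_bounds al u; move/le_trans; apply.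
rewrite /H -[leRHS]mulrA ler_wpM2l ?divr_ge0// big_split/= mulrA ler_peMl//.
  exact/ltW/base_mix_vec_gt0.
rewrite -expR_sum -expRD -[leLHS]expR0 ler_expR -mulr_sumr.
have : t ^+ 2 <= \sum_(i < d) (tnth u i : R) ^+ 2.
  rewrite -[leRHS]sqr_sqrtr ?sumr_ge0// => [|i _]; last exact: sqr_ge0.
  by rewrite lerXn2r ?nnegrE ?sqrtr_ge0 ?(ltW t0) ?(ltW tu).
lra.
Qed.

End family.

(** * The number of degrees and the lower bound *)

Section calibration.
Context {R : realType}.

(** The two requirements on the number m of degrees: the growth Q ^ m of the
    perturbations must stay of order sqrt n, and m must be of order log n.  The
    successor of the integer part of ln n / (2 * ln Q) satisfies both. *)
Lemma exists_log_grid (Q : R) (n : nat) : 1 < Q -> (2 <= n)%N ->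
  exists m : nat, Q ^+ m <= Q * Num.sqrt n%:R /\ ln n%:R <= 2 * ln Q * m%:R.
Proof.
move=> Q1 n2.
have Q0 : 0 < Q by apply: lt_trans Q1.
have lQ0 : 0 < ln Q by exact: ln_gt0.
have n0 : 0 < n%:R :> R by rewrite ltr0n (leq_trans _ n2).
have ln0 : 0 <= ln n%:R :> R by rewrite ln_ge0// ler1n (leq_trans _ n2).
pose y : R := ln n%:R / (2 * ln Q).
have y0 : 0 <= y by rewrite divr_ge0// mulr_ge0// ltW.
have /andP[ky yk] := Num.Theory.truncn_itv y0.
set k := Num.truncn y in ky yk.
have l2Q : 0 < 2 * ln Q by rewrite mulr_gt0.
exists k.+1; split; last first.
  by rewrite mulrC -ler_pdivrMr// ltW.
rewrite exprS ler_wpM2l ?(ltW Q0)//.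
rewrite -(ler_pXn2r (n := 2)) ?nnegrE ?sqrtr_ge0 ?exprn_ge0 ?(ltW Q0)//.
rewrite sqr_sqrtr ?(ltW n0)// -[leRHS]lnK ?posrE// -[X in X ^+ k]lnK ?posrE//.
rewrite -expRM_natl -expRM_natl ler_expR.
by move: ky; rewrite ler_pdivlMr// => ?; lra.
Qed.

(** All m ^ d perturbations, of size (b ^ m) ^ d each, add up to at most one half of
    the base; m <= 2 ^ m absorbs their number. *)
Lemma grid_small (b : R) (d m n : nat) : 1 <= b -> (0 < n)%N ->
  ((2 * b) ^+ d) ^+ m <= (2 * b) ^+ d * Num.sqrt n%:R ->
  (2 * (2 * b) ^+ d * Num.sqrt n%:R)^-1 *
    ((m ^ d)%N%:R * (b ^+ m) ^+ d) <= 2^-1.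
Proof.
move=> b1 n0 Qm.
have b0 : 0 <= b by lra.
have s0 : 0 < Num.sqrt n%:R :> R by rewrite sqrtr_gt0 ltr0n.
have Q0 : 0 < (2 * b) ^+ d by rewrite exprn_gt0//; lra.
rewrite mulrC ler_pdivrMr ?mulr_gt0//.
have -> : 2^-1 * (2 * (2 * b) ^+ d * Num.sqrt n%:R) = (2 * b) ^+ d * Num.sqrt n%:R by field.
apply: le_trans Qm; rewrite -[leRHS]exprM mulnC exprM natrX -exprMn.
rewrite lerXn2r ?nnegrE ?mulr_ge0 ?exprn_ge0//; first by lra.
rewrite exprMn ler_wpM2r ?exprn_ge0// -natrX ler_nat.
exact/ltnW/ltn_expl.
Qed.

End calibration.

Theorem theorem2p2 (R : realType) (d : nat) (hd : (1 <= d)%N) :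
  exists2 c : R, 0 < c &
    forall n : nat, (2 <= n)%N -> forall Gamma : R, c^-1 <= Gamma ->
      ((c * (ln n%:R ^+ d / n%:R))%:E <=
         minimax_risk n (mixture_class (subgauss_class d Gamma)))%E.
Proof.
have [B B1 bumpB] := @bump_mix_le R.
pose Q := (2 * B) ^+ d.
have Q1 : 1 < Q by rewrite exprn_egt1 -?lt0n//; lra.
have Q0 : 0 < Q by apply: lt_trans Q1.
have lQ0 : 0 < ln Q by exact: ln_gt0.
pose T : R := 3 / 2 * (gmass (1 / 8) / gmass (1 / 4)) ^+ d.
(* 4 * Q ^ 2 comes from eps ^ 2, 6 from [pobs_separation], 32 from [assouad], and
   (2 * ln Q) ^ d from the lower bound on m. *)
pose c1 : R := (4 * Q ^+ 2 * 6 * 32 * (2 * ln Q) ^+ d)^-1.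
have c10 : 0 < c1.
  rewrite invr_gt0; apply: mulr_gt0; last by rewrite exprn_gt0// mulr_gt0.
  by do 2 apply: mulr_gt0 => //; rewrite mulr_gt0 // exprn_gt0.
(* 8 and T are the constants of [pmix_tail]. *)
pose G0 : R := Num.max 8 T.
have G00 : 0 < G0 by rewrite lt_max ltr0n.
have cpos : 0 < Num.min c1 G0^-1 by rewrite lt_min c10 invr_gt0.
exists (Num.min c1 G0^-1) => // n n2 Gamma hGamma.
have n0 : (0 < n)%N by rewrite (leq_trans _ n2).
have nR : 0 < n%:R :> R by rewrite ltr0n.
have GG : G0 <= Gamma.
  apply: le_trans hGamma; rewrite -[leLHS]invrK lef_pV2 ?posrE ?invr_gt0//.
  by rewrite ge_min lexx orbT.
have /andP[G8 GT] : (8 <= Gamma) && (T <= Gamma).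
  by rewrite !(le_trans _ GG)// le_max lexx ?orbT.
have [m [Qm lnm]] := exists_log_grid Q1 n2.
pose eps : R := (2 * Q * Num.sqrt n%:R)^-1.
have s0 : 0 < Num.sqrt n%:R :> R by rewrite sqrtr_gt0.
have eps0 : 0 <= eps by rewrite invr_ge0 !mulr_ge0// ltW.
have cardI : #|{: {ffun 'I_d -> 'I_m}}| = (m ^ d)%N by rewrite card_ffun !card_ord.
have small : eps * (#|{: {ffun 'I_d -> 'I_m}}|%:R * (B ^+ m) ^+ d) <= 2^-1.
  by rewrite cardI; exact: grid_small.
have eps2 : eps ^+ 2 = (4 * Q ^+ 2 * n%:R)^-1.
  by rewrite exprVn !exprMn sqr_sqrtr ?ler0n//; congr (_ * _ * _)^-1; ring.
pose f := pobs_density hd eps0 B1 bumpB small.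
have inclass al : mixture_class (subgauss_class d Gamma) (f al).
  exists (density_prob (pmix_density hd eps0 B1 bumpB small al)) => //= t t0.
  apply: (le_trans (pmix_tail hd eps0 B1 bumpB small al t0)); rewrite lee_fin.
  apply: ler_pM => //; rewrite ?expR_ge0//.
    by rewrite mulr_ge0// exprn_ge0// divr_ge0// ltW// gmass_gt0.
  rewrite ler_expR !mulNr lerN2 ler_wpM2l ?sqr_ge0// lef_pV2 ?posrE//.
  exact: lt_le_trans GG.
apply/ereal_infP => _ [fhat efhat <-].
set V := ereal_sup _.
have riskV al : (hellinger_risk fhat (f al) <= V)%E.
  by apply: ereal_sup_ubound; exists (f al).
(* [assouad] bounds real numbers; the supremum may be infinite. *)
have key S : (V <= S%:E)%E -> Num.min c1 G0^-1 * (ln n%:R ^+ d / n%:R) <= S.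
  move=> VS.
  have rho0 : 0 <= eps ^+ 2 / 6 by rewrite divr_ge0// sqr_ge0.
  have aff J al : ((1 - (4 * n%:R)^-1)%:E <= \int[lebesgue_vec R d]_x
      (Num.sqrt (f al x * f (flip J al) x))%:E)%E.
    apply: le_trans (pobs_affinity hd eps0 B1 bumpB small J al).
    rewrite lee_fin lerD2l lerN2 eps2 -[4 * Q ^+ 2 * _]mulrA !(invfM 4).
    rewrite (invfM (Q ^+ 2)).
    have Q21 : 1 <= Q ^+ 2 by apply: exprn_ege1; exact: ltW.
    have : (Q ^+ 2)^-1 <= 1 by rewrite invf_le1// (lt_le_trans _ Q21).
    have : 0 < (n%:R : R)^-1 by rewrite invr_gt0.
    move: (n%:R^-1 : R) ((Q ^+ 2)^-1) => x y x0 y1.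
    have := ler_wpM2l (ltW x0) y1; lra.
  apply: le_trans (assouad n0 rho0 (pobs_separation hd eps0 B1 bumpB small) aff efhat
    (fun al => le_trans (riskV al) VS)).
  rewrite cardI natrX eps2.
  apply: (@le_trans _ _ (c1 * (ln n%:R ^+ d / n%:R))).
    rewrite ler_wpM2r ?ge_min ?lexx// divr_ge0// exprn_ge0// ln_ge0// ler1n.
    exact: ltnW.
  apply: (@le_trans _ _ (c1 * ((2 * ln Q * m%:R) ^+ d / n%:R))).
    rewrite ler_wpM2l ?(ltW c10)// ler_wpM2r ?invr_ge0 ?(ltW nR)//.
    rewrite lerXn2r ?nnegrE ?mulr_ge0 ?(ltW lQ0)//.
    by rewrite ln_ge0// ler1n ltnW.
  rewrite exprMn /c1 le_eqVlt; apply/orP; left; apply/eqP.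
  have : 0 < (2 * ln Q) ^+ d by rewrite exprn_gt0// mulr_gt0.
  move: ((2 * ln Q) ^+ d) => z z0; field.
  by rewrite !gt_eqF.
have V0 : (0 <= V)%E.
  apply: le_trans (riskV [ffun=> true]).
  by apply: integral_ge0 => X _; exact: hellinger2_ge0.
case: V V0 riskV key => [r||] // _ _ key; last exact: leey.
by rewrite lee_fin; exact: key.
Qed.
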